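(* Let $\nu\in\mathbb{R}$ and $-\nu<u^1<u^2<u^3$. Put $R(\lambda)=(\lambda+\nu)(\lambda-u^1)(\lambda-u^2)(\lambda-u^3)$, $k=2\pi\left(\oint_a(\lambda+\nu)d\lambda/\sqrt{R(\lambda)}\right)^{-1}$ ($a$ a cycle on $y^2=R(\lambda)$ encircling $[u^1,u^2]$), $\omega=(2\nu+u^1+u^2+u^3)k$, and $C^i=\partial_{u^i}\omega/\partial_{u^i}k$, $i=1,2,3$ (these are the characteristic speeds of the one-phase Whitham modulation equations $\partial_tu^i+C^i(\boldsymbol u)\partial_xu^i=0$ of the Camassa--Holm equation ${\tt u}_t+3{\tt u}{\tt u}_x={\tt u}_{xxt}+2{\tt u}_x{\tt u}_{xx}+{\tt u}{\tt u}_{xxx}-2\nu{\tt u}_x$ in Riemann invariants). Then $$C^1=u^1+u^2+u^3+2\nu+\frac{2(u^1+\nu)(u^1-u^2)\Lambda(K(s),\rho,s)}{(u^2+\nu)[K(s)-E(s)]},$$ $$C^2=u^1+u^2+u^3+2\nu+\frac{2(u^2-u^1)\Lambda(K(s),\rho,s)}{K(s)-\dfrac{(u^2+\nu)(u^3-u^1)}{(u^1+\nu)(u^3-u^2)}E(s)},$$ $$C^3=u^1+u^2+u^3+2\nu+\frac{2(u^1+\nu)(u^3-u^2)\Lambda(K(s),\rho,s)}{(u^2+\nu)E(s)},$$ where $s^2=\dfrac{(u^2-u^1)(u^3+\nu)}{(u^3-u^1)(u^2+\nu)}$ and $\rho^2=\dfrac{u^2-u^1}{u^2+\nu}$. The equations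 $\partial_tu^i+C^i(\boldsymbol u)\partial_xu^i=0$ are hyperbolic, and for $-\nu<u^1<u^2<u^3$ the speeds satisfy $C^1(\boldsymbol u)<C^3(\boldsymbol u)$ and $C^2(\boldsymbol u)<C^3(\boldsymbol u)$. In the limit when two Riemann invariants coalesce, the modulation equations reduce to the dispersionless Camassa--Holm equation $\partial_t{\tt u}+(3{\tt u}+2\nu)\partial_x{\tt u}=0$ (namely, when $u^2,u^3\to v$ one has $C^2=C^3$ in the limit and $C^1\to3u^1+2\nu$; when $u^1,u^2$ coalesce one has $C^1=C^2$ in the limit and $C^3\to3u^3+2\nu$).
   Context: $K(s)=\int_0^{\pi/2}d\psi/\sqrt{1-s^2\sin^2\psi}$ and $E(s)=\int_0^{\pi/2}\sqrt{1-s^2\sin^2\psi}\,d\psi$ are the complete elliptic integrals of the first and second kind with modulus $s$, and $\Lambda(K(s),\rho,s)=\int_0^{K(s)}\frac{dv}{1-\rho^2\,\mathrm{sn}^2 v}$ is the complete elliptic integral of the third kind, with $\mathrm{sn}$ the Jacobi elliptic function of modulus $s$. *)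

(* Defs.v *)
From Stdlib Require Import Reals ClassicalEpsilon.
From Coquelicot Require Import Coquelicot.
Open Scope R_scope.

Definition Kell (s : R) : R :=
  RInt (fun psi => / sqrt (1 - s ^ 2 * sin psi ^ 2)) 0 (PI / 2).
Definition Eell (s : R) : R :=
  RInt (fun psi => sqrt (1 - s ^ 2 * sin psi ^ 2)) 0 (PI / 2).

Definition Finc (s phi : R) : R :=
  RInt (fun psi => / sqrt (1 - s ^ 2 * sin psi ^ 2)) 0 phi.
(* Jacobi amplitude: the inverse of phi |-> F(phi, s) (unique for 0 <= s < 1). *)
Definition am (s v : R) : R := epsilon (inhabits 0) (fun phi => Finc s phi = v).
Definition sn (s v : R) : R := sin (am s v).

Definition Lam (x rho s : R) : R :=
  RInt (fun v => / (1 - rho ^ 2 * sn s v ^ 2)) 0 x.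

Definition Rpol (nu u1 u2 u3 l : R) : R := (l + nu) * (l - u1) * (l - u2) * (l - u3).

(* The a-period  oint_a (lambda+nu) dlambda / sqrt(R(lambda)), the cycle a
   encircling [u1,u2], where R > 0: equal to twice the (improper) integral
   over (u1,u2). *)
Definition aper (nu u1 u2 u3 : R) : R :=
  2 * RInt_gen (fun l => (l + nu) / sqrt (Rpol nu u1 u2 u3 l)) (at_right u1) (at_left u2).

Definition kwave (nu u1 u2 u3 : R) : R := 2 * PI / aper nu u1 u2 u3.
Definition omega (nu u1 u2 u3 : R) : R := (2 * nu + u1 + u2 + u3) * kwave nu u1 u2 u3.

Definition Cspeed1 (nu u1 u2 u3 : R) : R :=
  Derive (fun x => omega nu x u2 u3) u1 / Derive (fun x => kwave nu x u2 u3) u1.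
Definition Cspeed2 (nu u1 u2 u3 : R) : R :=
  Derive (fun x => omega nu u1 x u3) u2 / Derive (fun x => kwave nu u1 x u3) u2.
Definition Cspeed3 (nu u1 u2 u3 : R) : R :=
  Derive (fun x => omega nu u1 u2 x) u3 / Derive (fun x => kwave nu u1 u2 x) u3.

Definition smod (nu u1 u2 u3 : R) : R :=
  sqrt ((u2 - u1) * (u3 + nu) / ((u3 - u1) * (u2 + nu))).
Definition rhop (nu u1 u2 : R) : R := sqrt ((u2 - u1) / (u2 + nu)).

(* Main.v *)
Require Import Defs.
From Stdlib Require Import Reals Lra ClassicalEpsilon.
From Coquelicot Require Import Coquelicot.
Open Scope R_scope.

(** Let [a], [b], [c] be the branch points [u1], [u2], [u3] shifted by [nu], and put
    [W = b cos^2 t + a sin^2 t]. The substitution [lambda + nu = a b / W] turns the a-period into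
    [4 P], where
      [P = int_0^(PI/2) a b / (W sqrt (c W - a b)) dt = a Lambda / sqrt (b (c - a))].
    Along a curve in parameter space, with velocity [(a', b', c')], put
    [alpha = (c a' - a c') / (2 (c - a))] and [beta = (c b' - b c') / (2 (c - b))]. The variation of
    the integrand of [P] is then
      [(alpha sin^2 t + beta cos^2 t) / sqrt (c W - a b)]
    plus the [t]-derivative of
      [sin t cos t ((a' b - a b') / 2 + (alpha - beta) W) / (W sqrt (c W - a b))],
    which vanishes at both ends. Hence [P' = (alpha D + beta B) / sqrt (b (c - a))] with
    [D = int sin^2 / sqrt (1 - s^2 sin^2)] and [B = int cos^2 / sqrt (1 - s^2 sin^2)].
    As [C^i = S - P / d_i P] for [S = u1 + u2 + u3 + 2 nu], this gives
      [C^1 = S - 2 a (c - a) Lambda / (c D)], [C^2 = S - 2 a (c - b) Lambda / (c B)],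
      [C^3 = S + 2 a (c - b) Lambda / (b E)],
    so that [C^1, C^2 < S < C^3], and the closed forms follow from [K - E = s^2 D] and
    [E - (1 - s^2) K = s^2 B]. As [s -> 0], both [B] and [D] tend to [PI/4]. As [s -> 1], [B] stays
    bounded while [D] diverges logarithmically, [Lambda / D] tends to [1 / (1 - rho^2)], and
    [(1 - s^2) Lambda] tends to [0]. *)

Lemma ex_RInt_continuous_R (f : R -> R) (a b : R) : (forall t, continuous f t) -> ex_RInt f a b.
Proof. intros Hf; apply (ex_RInt_continuous (V := R_CompleteNormedModule)); auto. Qed.

Lemma RInt_ext_R (f g : R -> R) (a b : R) : a <= b ->
  (forall t, a < t < b -> f t = g t) -> RInt f a b = RInt g a b :> R.
Proof. intros Hab Hfg; apply RInt_ext; now rewrite Rmin_left, Rmax_right. Qed.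

Lemma RInt_Rmult (f : R -> R) (a b x : R) : ex_RInt f a b ->
  RInt (fun t => x * f t) a b = x * RInt f a b :> R.
Proof. exact (RInt_scal (V := R_CompleteNormedModule) f a b x). Qed.

Lemma RInt_linear (f g : R -> R) (a b x y : R) : ex_RInt f a b -> ex_RInt g a b ->
  RInt (fun t => x * f t + y * g t) a b = x * RInt f a b + y * RInt g a b :> R.
Proof.
  intros Hf Hg; apply is_RInt_unique, (is_RInt_plus (V := R_NormedModule));
    apply (is_RInt_scal (V := R_NormedModule));
    now apply (RInt_correct (V := R_CompleteNormedModule)).
Qed.

Lemma RInt_primitive (F f : R -> R) (a b : R) : a <= b ->
  (forall t, a <= t <= b -> is_derive F t (f t)) ->
  (forall t, a <= t <= b -> continuous f t) -> RInt f a b = F b - F a :> R.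
Proof.
  intros Hab HF Hf.
  apply is_RInt_unique, (is_RInt_derive (V := R_CompleteNormedModule));
    rewrite Rmin_left, Rmax_right by exact Hab; assumption.
Qed.

Lemma sin_sq_bounds (t : R) : 0 <= sin t ^ 2 <= 1.
Proof. generalize (sin2_cos2 t); unfold Rsqr; nra. Qed.

Lemma cos_sq (t : R) : cos t ^ 2 = 1 - sin t ^ 2.
Proof. generalize (sin2_cos2 t); unfold Rsqr; nra. Qed.

Lemma PI2_nonneg : 0 <= PI / 2.
Proof. exact (Rlt_le _ _ PI2_RGT_0). Qed.

Lemma continuous_of_derivable (f : R -> R) (x : R) : ex_derive f x -> continuous f x.
Proof. exact (ex_derive_continuous f x). Qed.

Ltac continuous_by_derivation :=
  intros; apply continuous_of_derivable; auto_derive; try exact I.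

Lemma RInt_cos_sq : RInt (fun t => cos t ^ 2) 0 (PI / 2) = PI / 4 :> R.
Proof.
  rewrite (RInt_primitive (fun t => (t + sin t * cos t) / 2)).
  - rewrite cos_PI2, sin_0; field.
  - exact PI2_nonneg.
  - intros t _; auto_derive; [trivial|]; generalize (cos_sq t); nra.
  - continuous_by_derivation.
Qed.

Lemma RInt_sin_sq : RInt (fun t => sin t ^ 2) 0 (PI / 2) = PI / 4 :> R.
Proof.
  rewrite (RInt_primitive (fun t => (t - sin t * cos t) / 2)).
  - rewrite cos_PI2, sin_0; field.
  - exact PI2_nonneg.
  - intros t _; auto_derive; [trivial|]; generalize (cos_sq t); nra.
  - continuous_by_derivation.
Qed.

Lemma RInt_cos_quarter : RInt cos 0 (PI / 2) = 1 :> R.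
Proof.
  rewrite (RInt_primitive sin).
  - rewrite sin_PI2, sin_0; ring.
  - exact PI2_nonneg.
  - intros t _; apply is_derive_sin.
  - intros t _; apply continuous_cos.
Qed.

(** * Complete elliptic integrals *)

Definition quad (p q t : R) : R := p * cos t ^ 2 + q * sin t ^ 2.

Lemma quad_pos (p q t : R) : 0 < p -> 0 < q -> 0 < quad p q t.
Proof.
  intros Hp Hq; unfold quad; rewrite cos_sq.
  generalize (sin_sq_bounds t); destruct (Rle_lt_dec p q); nra.
Qed.

Definition ellDelta (m t : R) : R := sqrt (1 - m * sin t ^ 2).

(* The parameter [m] is the square [s ^ 2] of the modulus. *)
Definition ell_RInt (m : R) (w : R -> R) : R := RInt (fun t => w t / ellDelta m t) 0 (PI / 2).

Definition ellK (m : R) : R := ell_RInt m (fun _ => 1).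
Definition ellE (m : R) : R := ell_RInt m (fun t => 1 - m * sin t ^ 2).
Definition ellB (m : R) : R := ell_RInt m (fun t => cos t ^ 2).
Definition ellD (m : R) : R := ell_RInt m (fun t => sin t ^ 2).
Definition ellPi (n m : R) : R := ell_RInt m (fun t => / (1 - n * sin t ^ 2)).

Lemma one_minus_sin_sq_pos (n t : R) : n < 1 -> 0 < 1 - n * sin t ^ 2.
Proof.
  intros Hn; replace (1 - n * sin t ^ 2) with (quad 1 (1 - n) t)
    by (unfold quad; rewrite cos_sq; ring).
  apply quad_pos; lra.
Qed.

Lemma continuous_inv_one_minus_sin_sq (n t : R) : n < 1 ->
  continuous (fun t => / (1 - n * sin t ^ 2)) t.
Proof.
  intros Hn; apply continuous_Rinv_comp; [continuous_by_derivation|].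
  apply Rgt_not_eq, one_minus_sin_sq_pos, Hn.
Qed.

Section Weights.

Variable m : R.
Hypothesis m_lt_1 : m < 1.

Lemma ellDelta_pos (t : R) : 0 < ellDelta m t.
Proof. apply sqrt_lt_R0, one_minus_sin_sq_pos, m_lt_1. Qed.

Lemma ellDelta_sq (t : R) : ellDelta m t ^ 2 = 1 - m * sin t ^ 2.
Proof. apply pow2_sqrt, Rlt_le, one_minus_sin_sq_pos, m_lt_1. Qed.

Lemma ellDelta_sq_cos (t : R) : ellDelta m t ^ 2 = cos t ^ 2 + (1 - m) * sin t ^ 2.
Proof. rewrite ellDelta_sq, cos_sq; ring. Qed.

Lemma continuous_inv_ellDelta (t : R) : continuous (fun t => / ellDelta m t) t.
Proof.
  apply continuous_Rinv_comp; [|apply Rgt_not_eq, ellDelta_pos].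
  apply continuous_sqrt_comp; continuous_by_derivation.
Qed.

Lemma continuous_weight (w : R -> R) (t : R) : continuous w t ->
  continuous (fun t => w t / ellDelta m t) t.
Proof.
  intros Hw; apply (continuous_mult (K := R_AbsRing)); [exact Hw|apply continuous_inv_ellDelta].
Qed.

Lemma ex_ell_RInt (w : R -> R) : (forall t, continuous w t) ->
  ex_RInt (fun t => w t / ellDelta m t) 0 (PI / 2).
Proof. intros Hw; apply ex_RInt_continuous_R; intros t; now apply continuous_weight. Qed.

Lemma ell_RInt_linear (f g h : R -> R) (x y : R) :
  (forall t, continuous f t) -> (forall t, continuous g t) ->
  (forall t, h t = x * f t + y * g t) ->
  ell_RInt m h = x * ell_RInt m f + y * ell_RInt m g.
Proof.
  intros Hf Hg Hh; unfold ell_RInt; rewrite <- RInt_linear by now apply ex_ell_RInt.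
  apply RInt_ext_R; [exact PI2_nonneg|]; intros t _; rewrite Hh; unfold Rdiv; ring.
Qed.

Lemma ell_RInt_le (f g : R -> R) :
  (forall t, continuous f t) -> (forall t, continuous g t) -> (forall t, f t <= g t) ->
  ell_RInt m f <= ell_RInt m g.
Proof.
  intros Hf Hg Hfg; apply RInt_le; [exact PI2_nonneg|now apply ex_ell_RInt..|].
  intros t _; apply Rmult_le_compat_r; [|apply Hfg].
  apply Rlt_le, Rinv_0_lt_compat, ellDelta_pos.
Qed.

End Weights.

Lemma Kell_ellK (s : R) : Kell s = ellK (s ^ 2).
Proof. apply RInt_ext_R; [exact PI2_nonneg|]; intros t _; symmetry; apply Rmult_1_l. Qed.

Lemma Eell_ellE (s : R) : s ^ 2 < 1 -> Eell s = ellE (s ^ 2).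
Proof.
  intros Hs; apply RInt_ext_R; [exact PI2_nonneg|]; intros t _.
  fold (ellDelta (s ^ 2) t); rewrite <- ellDelta_sq by exact Hs.
  pose proof (ellDelta_pos (s ^ 2) Hs t); field; lra.
Qed.

Lemma continuous_cos_sq (t : R) : continuous (fun t => cos t ^ 2) t.
Proof. continuous_by_derivation. Qed.

Lemma continuous_sin_sq (t : R) : continuous (fun t => sin t ^ 2) t.
Proof. continuous_by_derivation. Qed.

Lemma ellK_eq (m : R) : m < 1 -> ellK m = ellB m + ellD m.
Proof.
  intros Hm; transitivity (1 * ellB m + 1 * ellD m); [|ring].
  apply (ell_RInt_linear m Hm (fun t => cos t ^ 2) (fun t => sin t ^ 2));
    [apply continuous_cos_sq|apply continuous_sin_sq|].
  intros t; rewrite cos_sq; ring.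
Qed.

Lemma ellE_eq (m : R) : m < 1 -> ellE m = ellB m + (1 - m) * ellD m.
Proof.
  intros Hm; transitivity (1 * ellB m + (1 - m) * ellD m); [|ring].
  apply (ell_RInt_linear m Hm (fun t => cos t ^ 2) (fun t => sin t ^ 2));
    [apply continuous_cos_sq|apply continuous_sin_sq|].
  intros t; rewrite cos_sq; ring.
Qed.

Lemma ellDelta_bounds (m t : R) : 0 <= m < 1 -> sqrt (1 - m) <= ellDelta m t <= 1.
Proof.
  intros Hm; generalize (sin_sq_bounds t); intros Ht; split.
  - apply sqrt_le_1_alt; nra.
  - rewrite <- sqrt_1; apply sqrt_le_1_alt; nra.
Qed.

Lemma inv_ellDelta_bounds (m t : R) : 0 <= m < 1 -> 1 <= / ellDelta m t <= / sqrt (1 - m).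
Proof.
  intros Hm; pose proof (ellDelta_bounds m t Hm); pose proof (ellDelta_pos m ltac:(lra) t).
  assert (0 < sqrt (1 - m)) by (apply sqrt_lt_R0; lra).
  split; [rewrite <- Rinv_1|]; apply Rinv_le_contravar; lra.
Qed.

Lemma ell_RInt_bounds (m : R) (w : R -> R) : 0 <= m < 1 ->
  (forall t, continuous w t) -> (forall t, 0 <= w t) ->
  RInt w 0 (PI / 2) <= ell_RInt m w <= RInt w 0 (PI / 2) * / sqrt (1 - m).
Proof.
  intros Hm Hw Hpos; pose proof PI2_nonneg.
  pose proof (ex_RInt_continuous_R w 0 (PI / 2) Hw).
  pose proof (ex_ell_RInt m ltac:(lra) w Hw).
  split.
  - apply RInt_le; trivial; intros t _.
    generalize (Hpos t) (inv_ellDelta_bounds m t Hm); unfold Rdiv; nra.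
  - rewrite Rmult_comm, <- RInt_Rmult by assumption.
    apply RInt_le; trivial.
    + now apply (ex_RInt_scal (V := R_NormedModule)).
    + intros t _; generalize (Hpos t) (inv_ellDelta_bounds m t Hm); unfold Rdiv; nra.
Qed.

Lemma ellB_ge (m : R) : 0 <= m < 1 -> PI / 4 <= ellB m.
Proof.
  intros Hm; rewrite <- RInt_cos_sq.
  apply (ell_RInt_bounds m (fun t => cos t ^ 2) Hm continuous_cos_sq).
  intros t; apply pow2_ge_0.
Qed.

Lemma ellD_ge (m : R) : 0 <= m < 1 -> PI / 4 <= ellD m.
Proof.
  intros Hm; rewrite <- RInt_sin_sq.
  apply (ell_RInt_bounds m (fun t => sin t ^ 2) Hm continuous_sin_sq).
  intros t; apply pow2_ge_0.
Qed.

Lemma ellB_pos (m : R) : 0 <= m < 1 -> 0 < ellB m.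
Proof. intros Hm; pose proof (ellB_ge m Hm); generalize PI_RGT_0; lra. Qed.

Lemma ellD_pos (m : R) : 0 <= m < 1 -> 0 < ellD m.
Proof. intros Hm; pose proof (ellD_ge m Hm); generalize PI_RGT_0; lra. Qed.

Lemma ellK_pos (m : R) : 0 <= m < 1 -> 0 < ellK m.
Proof.
  intros Hm; rewrite ellK_eq by lra; pose proof (ellB_pos m Hm); pose proof (ellD_pos m Hm); lra.
Qed.

Lemma ellE_ge (m : R) : 0 <= m < 1 -> PI / 4 <= ellE m.
Proof.
  intros Hm; rewrite ellE_eq by lra; pose proof (ellB_ge m Hm); pose proof (ellD_pos m Hm); nra.
Qed.

Lemma ellE_pos (m : R) : 0 <= m < 1 -> 0 < ellE m.
Proof. intros Hm; pose proof (ellE_ge m Hm); generalize PI_RGT_0; lra. Qed.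

Lemma ellK_le (m : R) : 0 <= m < 1 -> ellK m <= PI / 2 * / sqrt (1 - m).
Proof.
  intros Hm; apply Rle_trans with (RInt (fun _ => 1) 0 (PI / 2) * / sqrt (1 - m)).
  - apply (ell_RInt_bounds m (fun _ => 1) Hm); intros t; [apply continuous_const|lra].
  - right; rewrite (RInt_const (V := R_CompleteNormedModule)).
    unfold scal; simpl; unfold mult; simpl; ring.
Qed.

Lemma cos_le_ellDelta (m t : R) : m < 1 -> cos t <= ellDelta m t.
Proof.
  intros Hm; generalize (ellDelta_pos m Hm t) (ellDelta_sq_cos m Hm t) (sin_sq_bounds t); nra.
Qed.

Lemma ellB_le_1 (m : R) : m < 1 -> ellB m <= 1.
Proof.
  intros Hm; rewrite <- RInt_cos_quarter; apply RInt_le.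
  - exact PI2_nonneg.
  - apply ex_ell_RInt; [exact Hm|apply continuous_cos_sq].
  - apply ex_RInt_continuous_R, continuous_cos.
  - intros t Ht; apply Rle_div_l; [now apply ellDelta_pos|].
    assert (0 < cos t) by (apply cos_gt_0; lra).
    pose proof (cos_le_ellDelta m t Hm); nra.
Qed.

Lemma ellDelta_le_sqrt_plus_cos (m t : R) : m < 1 -> 0 <= cos t ->
  ellDelta m t <= sqrt (1 - m) + cos t.
Proof.
  intros Hm Ht; pose proof (sqrt_lt_R0 (1 - m) ltac:(lra)).
  pose proof (ellDelta_sq_cos m Hm t) as Hsq; rewrite <- (pow2_sqrt (1 - m)) in Hsq by lra.
  pose proof (sin_sq_bounds t).
  apply Rsqr_incr_0_var; [unfold Rsqr|lra].
  assert (0 <= sqrt (1 - m) ^ 2 * (1 - sin t ^ 2)) by (apply Rmult_le_pos; [apply pow2_ge_0|lra]).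
  assert (0 <= sqrt (1 - m) * cos t) by (apply Rmult_le_pos; lra).
  nra.
Qed.

Lemma ellK_ge_ln (m : R) : m < 1 -> - ln (sqrt (1 - m)) <= ellK m.
Proof.
  intros Hm; set (e := sqrt (1 - m)).
  assert (He : 0 < e) by (apply sqrt_lt_R0; lra).
  assert (Hcos : forall t, 0 <= t <= PI / 2 -> 0 <= cos t) by (intros t Ht; apply cos_ge_0; lra).
  assert (Hderiv : forall t, 0 <= t <= PI / 2 ->
            is_derive (fun t => - ln (e + cos t)) t (sin t / (e + cos t))).
  { intros t Ht; specialize (Hcos t Ht); auto_derive; [lra|field; lra]. }
  assert (Hcont : forall t, 0 <= t <= PI / 2 -> continuous (fun t => sin t / (e + cos t)) t).
  { intros t Ht; specialize (Hcos t Ht); continuous_by_derivation; lra. }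
  apply Rle_trans with (RInt (fun t => sin t / (e + cos t)) 0 (PI / 2)).
  - rewrite (RInt_primitive _ _ _ _ PI2_nonneg Hderiv Hcont), cos_PI2, cos_0, Rplus_0_r.
    assert (0 < ln (e + 1)) by (rewrite <- ln_1; apply ln_increasing; lra); lra.
  - apply RInt_le; [exact PI2_nonneg| | |].
    + apply (ex_RInt_continuous (V := R_CompleteNormedModule)).
      now rewrite Rmin_left, Rmax_right by exact PI2_nonneg.
    + apply ex_ell_RInt; [exact Hm|intros t; apply continuous_const].
    + intros t Ht; specialize (Hcos t ltac:(lra)).
      pose proof (ellDelta_pos m Hm t); pose proof (SIN_bound t).
      assert (ellDelta m t <= e + cos t) by now apply ellDelta_le_sqrt_plus_cos.
      apply Rle_trans with (1 * / (e + cos t)).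
      * apply Rmult_le_compat_r; [apply Rlt_le, Rinv_0_lt_compat|]; lra.
      * apply Rmult_le_compat_l; [lra|apply Rinv_le_contravar; lra].
Qed.

Lemma ellK_le_ellPi (n m : R) : 0 <= n < 1 -> m < 1 -> ellK m <= ellPi n m.
Proof.
  intros Hn Hm; apply (ell_RInt_le m Hm).
  - intros t; apply continuous_const.
  - intros t; apply continuous_inv_one_minus_sin_sq; lra.
  - intros t; pose proof (one_minus_sin_sq_pos n t ltac:(lra)); pose proof (sin_sq_bounds t).
    rewrite <- Rinv_1 at 1; apply Rinv_le_contravar; nra.
Qed.

Lemma ellPi_pos (n m : R) : 0 <= n < 1 -> 0 <= m < 1 -> 0 < ellPi n m.
Proof.
  intros Hn Hm; apply Rlt_le_trans with (ellK m); [now apply ellK_pos|].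
  apply ellK_le_ellPi; lra.
Qed.

Lemma ellPi_le (n m : R) : 0 <= n < 1 -> m < 1 -> ellPi n m <= / (1 - n) * ellK m.
Proof.
  intros Hn Hm; rewrite ellK_eq, Rmult_plus_distr_l by exact Hm.
  rewrite <- (ell_RInt_linear m Hm (fun t => cos t ^ 2) (fun t => sin t ^ 2) (fun _ => / (1 - n)));
    [|exact continuous_cos_sq|exact continuous_sin_sq|intros t; rewrite cos_sq; ring].
  apply (ell_RInt_le m Hm).
  - intros t; apply continuous_inv_one_minus_sin_sq; lra.
  - intros t; apply continuous_const.
  - intros t; pose proof (sin_sq_bounds t); apply Rinv_le_contravar; nra.
Qed.

(* The weight of [ellPi], as a function of [sin t ^ 2], lies above its tangent at [1]. *)
Lemma ellPi_ge (n m : R) : n < 1 -> m < 1 ->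
  / (1 - n) * ellD m + (1 - 2 * n) * / (1 - n) ^ 2 * ellB m <= ellPi n m.
Proof.
  intros Hn Hm.
  rewrite <- (ell_RInt_linear m Hm (fun t => sin t ^ 2) (fun t => cos t ^ 2)
    (fun t => / (1 - n) * sin t ^ 2 + (1 - 2 * n) * / (1 - n) ^ 2 * cos t ^ 2));
    [|exact continuous_sin_sq|exact continuous_cos_sq|reflexivity].
  apply (ell_RInt_le m Hm).
  - continuous_by_derivation.
  - intros t; now apply continuous_inv_one_minus_sin_sq.
  - intros t; pose proof (one_minus_sin_sq_pos n t Hn) as Hpos.
    rewrite cos_sq; apply Rminus_le_0.
    replace (_ - _) with ((n * (1 - sin t ^ 2)) ^ 2 / ((1 - n * sin t ^ 2) * (1 - n) ^ 2))
      by (field; lra).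
    apply Rdiv_le_0_compat; [apply pow2_ge_0|].
    apply Rmult_lt_0_compat; [|apply pow_lt]; lra.
Qed.

(** * The Jacobi amplitude *)

Section Amplitude.

Variable s : R.
Hypothesis s_sq_lt_1 : s ^ 2 < 1.

Lemma is_derive_Finc (phi : R) : is_derive (Finc s) phi (/ ellDelta (s ^ 2) phi).
Proof.
  apply (is_derive_RInt (V := R_NormedModule) (fun t => / ellDelta (s ^ 2) t) (Finc s) 0).
  - apply filter_forall; intros t; apply (RInt_correct (V := R_CompleteNormedModule)).
    apply ex_RInt_continuous_R, continuous_inv_ellDelta, s_sq_lt_1.
  - apply continuous_inv_ellDelta, s_sq_lt_1.
Qed.

Lemma continuity_Finc : continuity (Finc s).
Proof.
  intros t; apply derivable_continuous_pt; eexists; apply is_derive_Reals, is_derive_Finc.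
Qed.

Lemma Finc_0 : Finc s 0 = 0.
Proof. apply (RInt_point (V := R_CompleteNormedModule)). Qed.

Lemma Finc_mean_value (x y : R) :
  exists k : R, 1 <= k /\ Finc s x - Finc s y = k * (x - y).
Proof.
  destruct (MVT_gen (Finc s) y x (fun t => / ellDelta (s ^ 2) t)) as [t [_ Ht]].
  - intros t _; apply is_derive_Finc.
  - intros t _; apply continuity_Finc.
  - exists (/ ellDelta (s ^ 2) t); split; [|exact Ht].
    apply inv_ellDelta_bounds; split; [apply pow2_ge_0|exact s_sq_lt_1].
Qed.

Lemma Finc_expanding (x y : R) : Rabs (x - y) <= Rabs (Finc s x - Finc s y).
Proof.
  destruct (Finc_mean_value x y) as [k [Hk ->]].
  rewrite Rabs_mult, (Rabs_pos_eq k) by lra.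
  generalize (Rabs_pos (x - y)); nra.
Qed.

Lemma Finc_surjective (v : R) : exists phi : R, Finc s phi = v.
Proof.
  destruct (Finc_mean_value v 0) as [k [Hk Hv]]; rewrite Finc_0, !Rminus_0_r in Hv.
  destruct (IVT_gen (Finc s) 0 v v continuity_Finc) as [phi [_ Hphi]].
  - rewrite Finc_0, Hv; destruct (Rle_lt_dec 0 v).
    + rewrite Rmin_left, Rmax_right; nra.
    + rewrite Rmin_right, Rmax_left; nra.
  - now exists phi.
Qed.

Lemma Finc_am (v : R) : Finc s (am s v) = v.
Proof. exact (epsilon_spec _ _ (Finc_surjective v)). Qed.

Lemma am_lipschitz (v w : R) : Rabs (am s v - am s w) <= Rabs (v - w).
Proof. rewrite <- (Finc_am v), <- (Finc_am w) at 2; apply Finc_expanding. Qed.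

Lemma am_Finc (phi : R) : am s (Finc s phi) = phi.
Proof.
  pose proof (Finc_expanding (am s (Finc s phi)) phi) as Hexpand.
  rewrite Finc_am, Rminus_diag, Rabs_R0 in Hexpand.
  apply Rminus_diag_uniq, Rabs_eq_0; generalize (Rabs_pos (am s (Finc s phi) - phi)); lra.
Qed.

Lemma continuous_am (v : R) : continuous (am s) v.
Proof.
  apply filterlim_locally; intros eps; exists eps; intros w Hw.
  exact (Rle_lt_trans _ _ _ (am_lipschitz w v) Hw).
Qed.

Lemma Lam_Kell (rho : R) : rho ^ 2 < 1 -> Lam (Kell s) rho s = ellPi (rho ^ 2) (s ^ 2).
Proof.
  intros Hrho; unfold Lam, sn; rewrite <- Finc_0 at 1; change (Kell s) with (Finc s (PI / 2)).
  rewrite <- (RInt_comp (V := R_CompleteNormedModule) _ (Finc s)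
               (fun t => / ellDelta (s ^ 2) t)).
  - apply RInt_ext_R; [exact PI2_nonneg|]; intros t _.
    rewrite am_Finc; apply Rmult_comm.
  - intros t _; apply (continuous_comp (am s) (fun x => / (1 - rho ^ 2 * sin x ^ 2))).
    + apply continuous_am.
    + now apply continuous_inv_one_minus_sin_sq.
  - intros t _; split; [apply is_derive_Finc|now apply continuous_inv_ellDelta].
Qed.

End Amplitude.

(** * The period as a regular integral *)

Lemma locally_Ioo (p q x : R) : p < x < q -> locally x (fun y => p < y < q).
Proof. exact (open_and _ _ (open_gt p) (open_lt q) x). Qed.

Lemma at_right_Ioo (p q : R) : p < q -> at_right p (fun x => p < x < q).
Proof.
  intros Hpq; unfold at_right, within.
  apply (filter_imp (fun x => x < q)); [now split|exact (open_lt q p Hpq)].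
Qed.

Lemma at_left_Ioo (p q : R) : p < q -> at_left q (fun x => p < x < q).
Proof.
  intros Hpq; unfold at_left, within.
  apply (filter_imp (fun x => p < x)); [now split|exact (open_gt p q Hpq)].
Qed.

Lemma Ioo_convex (p q x y z : R) : p < x < q -> p < y < q ->
  Rmin x y <= z <= Rmax x y -> p < z < q.
Proof.
  intros Hx Hy; unfold Rmin, Rmax; destruct (Rle_dec x y); lra.
Qed.

Lemma is_RInt_gen_primitive (F f : R -> R) (p q : R) : p < q ->
  (forall x, p < x < q -> is_derive F x (f x)) ->
  (forall x, p < x < q -> continuous f x) ->
  continuous F p -> continuous F q ->
  is_RInt_gen f (at_right p) (at_left q) (F q - F p).
Proof.
  intros Hpq HF Hf Hp Hq.
  assert (Hinside : filter_prod (at_right p) (at_left q) (fun xy =>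
            forall z, Rmin (fst xy) (snd xy) <= z <= Rmax (fst xy) (snd xy) -> p < z < q)).
  { exists (fun x => p < x < q) (fun y => p < y < q);
      [now apply at_right_Ioo|now apply at_left_Ioo|].
    intros x y Hx Hy z; now apply Ioo_convex. }
  apply (is_RInt_gen_ext (Derive F)); [|apply is_RInt_gen_Derive].
  - revert Hinside; apply filter_imp; intros xy Hxy z Hz.
    apply is_derive_unique, HF, Hxy; lra.
  - revert Hinside; apply filter_imp; intros xy Hxy z Hz; exists (f z); auto.
  - revert Hinside; apply filter_imp; intros xy Hxy z Hz.
    apply (continuous_ext_loc _ f); [|auto].
    generalize (locally_Ioo p q z (Hxy z Hz)); apply filter_imp; intros y Hy.
    symmetry; now apply is_derive_unique, HF.
  - apply (filterlim_filter_le_1 (F := locally p)); [apply filter_le_within|exact Hp].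
  - apply (filterlim_filter_le_1 (F := locally q)); [apply filter_le_within|exact Hq].
Qed.

Lemma is_RInt_gen_subst (f h tau dtau : R -> R) (p q : R) : p < q ->
  (forall t, continuous h t) -> (forall x, p < x < q -> continuous f x) ->
  (forall x, p < x < q -> is_derive tau x (dtau x)) ->
  (forall x, p < x < q -> dtau x * h (tau x) = f x) ->
  continuous tau p -> continuous tau q ->
  is_RInt_gen f (at_right p) (at_left q) (RInt h (tau p) (tau q)).
Proof.
  intros Hpq Hh Hf Htau Hfh Hp Hq.
  assert (HH : forall t, is_derive (RInt h (tau p)) t (h t)).
  { intros t; apply (is_derive_RInt (V := R_NormedModule) h _ (tau p)); [|apply Hh].
    apply filter_forall; intros y; apply (RInt_correct (V := R_CompleteNormedModule)).
    now apply ex_RInt_continuous_R. }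
  assert (Hcont : forall x, continuous tau x -> continuous (fun x => RInt h (tau p) (tau x)) x).
  { intros x Hx; apply (continuous_comp tau (RInt h (tau p))); [exact Hx|].
    apply continuous_of_derivable; eexists; apply HH. }
  replace (RInt h (tau p) (tau q)) with (RInt h (tau p) (tau q) - RInt h (tau p) (tau p))
    by (rewrite (RInt_point (V := R_CompleteNormedModule)); apply Rminus_0_r).
  apply (is_RInt_gen_primitive (fun x => RInt h (tau p) (tau x))); auto.
  intros x Hx; rewrite <- Hfh by exact Hx.
  apply (is_derive_comp (V := R_NormedModule) (RInt h (tau p)) tau); auto.
Qed.

Lemma is_derive_acos (x : R) : -1 < x < 1 -> is_derive acos x (- 1 / sqrt (1 - x ^ 2)).
Proof.
  intros Hx; apply is_derive_Reals; replace (x ^ 2) with (Rsqr x) by (unfold Rsqr; ring).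
  rewrite <- (derive_pt_acos x Hx); apply derive_pt_eq_1 with (derivable_pt_acos x Hx).
  reflexivity.
Qed.

Lemma continuous_acos_1 : continuous acos 1.
Proof.
  apply (continuous_ext_loc _ (fun x => atan (sqrt (1 - x ^ 2) / x))).
  - apply (filter_imp (fun x => 0 < x < 2)); [|apply locally_Ioo; lra].
    intros x Hx; rewrite acos_atan by lra; do 4 f_equal; unfold Rsqr; ring.
  - apply (continuous_comp (fun x => sqrt (1 - x ^ 2) / x) atan).
    + apply (continuous_mult (K := R_AbsRing)).
      * apply continuous_sqrt_comp; continuous_by_derivation.
      * apply continuous_Rinv; lra.
    + apply continuous_of_derivable; eexists; apply is_derive_atan.
Qed.

Lemma continuous_acos (x : R) : -1 <= x <= 1 -> continuous acos x.
Proof.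
  intros Hx.
  destruct (Req_dec x 1) as [->|Hx1]; [exact continuous_acos_1|].
  destruct (Req_dec x (-1)) as [->|Hx2].
  - assert (Hreflect : forall y, PI - acos (- y) = acos y) by (intros y; rewrite acos_opp; ring).
    apply (continuous_ext _ _ _ Hreflect).
    apply (continuous_minus (V := R_NormedModule)); [apply continuous_const|].
    apply (continuous_comp Ropp acos); [continuous_by_derivation|].
    replace (- (-1)) with 1 by ring; exact continuous_acos_1.
  - apply continuous_of_derivable; eexists; apply is_derive_acos; lra.
Qed.

Definition period_integrand (a b c t : R) : R :=
  a * b / (quad b a t * sqrt (c * quad b a t - a * b)).
Definition period (a b c : R) : R := RInt (period_integrand a b c) 0 (PI / 2).

Lemma continuous_quad (p q t : R) : continuous (quad p q) t.
Proof. unfold quad; continuous_by_derivation. Qed.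

Section Period.

Variables a b c : R.
Hypotheses (a_pos : 0 < a) (a_lt_b : a < b) (b_lt_c : b < c).

Lemma quad_ba_bounds (t : R) : a <= quad b a t <= b.
Proof. generalize (sin_sq_bounds t); unfold quad; rewrite cos_sq; nra. Qed.

Lemma period_radicand_pos (t : R) : 0 < c * quad b a t - a * b.
Proof. generalize (quad_ba_bounds t); nra. Qed.

Lemma continuous_inv_period_root (t : R) :
  continuous (fun t => / sqrt (c * quad b a t - a * b)) t.
Proof.
  apply continuous_Rinv_comp.
  - apply continuous_sqrt_comp; unfold quad; continuous_by_derivation.
  - apply Rgt_not_eq, sqrt_lt_R0, period_radicand_pos.
Qed.

Lemma continuous_period_integrand (t : R) : continuous (period_integrand a b c) t.
Proof.
  apply (continuous_ext (fun t => a * b * / quad b a t * / sqrt (c * quad b a t - a * b))).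
  - intros y; unfold period_integrand, Rdiv; rewrite Rinv_mult; apply Rmult_assoc.
  - apply (continuous_mult (K := R_AbsRing)); [|apply continuous_inv_period_root].
    apply (continuous_mult (K := R_AbsRing)); [apply continuous_const|].
    apply continuous_Rinv_comp; [apply continuous_quad|].
    generalize (quad_ba_bounds t); lra.
Qed.

Lemma ex_RInt_period : ex_RInt (period_integrand a b c) 0 (PI / 2).
Proof. apply ex_RInt_continuous_R, continuous_period_integrand. Qed.

End Period.

(* Since [quad b a t = ((a + b) + (b - a) * cos (2 * t)) / 2], the equation
   [quad b a t = a * b / x] determines [cos (2 * t)]. *)
Definition cycle_cosine (a b x : R) : R := (2 * a * b / x - (a + b)) / (b - a).
Definition cycle_angle (a b x : R) : R := acos (cycle_cosine a b x) / 2.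

Section CycleAngle.

Variables a b : R.
Hypotheses (a_pos : 0 < a) (a_lt_b : a < b).

Lemma cycle_cosine_compl (x : R) : x <> 0 ->
  1 - cycle_cosine a b x ^ 2
  = 4 * (a * b * ((b - x) * (x - a))) / (x * (b - a)) ^ 2.
Proof. intros Hx; unfold cycle_cosine; field; lra. Qed.

Lemma cycle_cosine_bounds (x : R) : a <= x <= b ->
  -1 <= cycle_cosine a b x <= 1.
Proof.
  intros Hx.
  assert (0 <= 1 - cycle_cosine a b x ^ 2); [|nra].
  rewrite cycle_cosine_compl by lra.
  apply Rdiv_le_0_compat; [|apply pow_lt; nra].
  repeat apply Rmult_le_pos; lra.
Qed.

Lemma cycle_angle_left : cycle_angle a b a = 0.
Proof.
  unfold cycle_angle.
  replace (cycle_cosine a b a) with 1 by (unfold cycle_cosine; field; lra).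
  rewrite acos_1; field.
Qed.

Lemma cycle_angle_right : cycle_angle a b b = PI / 2.
Proof.
  unfold cycle_angle.
  replace (cycle_cosine a b b) with (- (1)) by (unfold cycle_cosine; field; lra).
  rewrite acos_opp, acos_1; field.
Qed.

Lemma quad_cycle_angle (x : R) : a <= x <= b -> quad b a (cycle_angle a b x) = a * b / x.
Proof.
  intros Hx.
  assert (Hcos : cos (2 * cycle_angle a b x) = cycle_cosine a b x).
  { unfold cycle_angle; replace (2 * (_ / 2)) with (acos (cycle_cosine a b x)) by field.
    now apply cos_acos, cycle_cosine_bounds. }
  replace (quad b a (cycle_angle a b x))
    with (((a + b) + (b - a) * cos (2 * cycle_angle a b x)) / 2)
    by (rewrite cos_2a_cos; unfold quad; generalize (cos_sq (cycle_angle a b x)); nra).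
  rewrite Hcos; unfold cycle_cosine; field; lra.
Qed.

Lemma continuous_cycle_angle (x : R) : a <= x <= b -> continuous (cycle_angle a b) x.
Proof.
  intros Hx; unfold cycle_angle.
  apply (continuous_mult (K := R_AbsRing)); [|apply continuous_const].
  apply (continuous_comp (cycle_cosine a b) acos).
  - unfold cycle_cosine; continuous_by_derivation; lra.
  - now apply continuous_acos, cycle_cosine_bounds.
Qed.

Lemma is_derive_cycle_angle (x : R) : a < x < b ->
  is_derive (cycle_angle a b) x (a * b / (2 * x * sqrt (a * b * ((b - x) * (x - a))))).
Proof.
  intros Hx.
  assert (Hrad : 0 < a * b * ((b - x) * (x - a))) by (repeat apply Rmult_lt_0_compat; lra).
  assert (Hscale : 0 < x * (b - a)) by (apply Rmult_lt_0_compat; lra).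
  pose proof (cycle_cosine_compl x ltac:(lra)) as Hcompl.
  assert (Hz : -1 < cycle_cosine a b x < 1).
  { assert (0 < 1 - cycle_cosine a b x ^ 2); [|nra].
    rewrite Hcompl; apply Rdiv_lt_0_compat; [|apply pow_lt]; lra. }
  pose proof (sqrt_lt_R0 _ Hrad).
  unfold cycle_angle; evar_last.
  - apply (is_derive_comp (fun z => acos z / 2) (cycle_cosine a b)).
    + apply (is_derive_div acos (fun _ => 2));
        [now apply is_derive_acos|apply is_derive_const|lra].
    + unfold cycle_cosine; auto_derive; [lra|reflexivity].
  - rewrite Hcompl, sqrt_div_alt, sqrt_pow2, sqrt_mult_alt by (lra || apply pow_lt, Hscale).
    replace (sqrt 4) with 2 by (replace 4 with (2 ^ 2) by ring; rewrite sqrt_pow2; lra).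
    unfold scal, zero; simpl; unfold mult; simpl; field; lra.
Qed.

End CycleAngle.

Lemma Rpol_pos (nu u1 u2 u3 l : R) : - nu < u1 -> u1 < l < u2 -> u2 < u3 ->
  0 < Rpol nu u1 u2 u3 l.
Proof.
  intros Hu1 Hl Hu3; unfold Rpol.
  replace (_ * _) with ((l + nu) * (l - u1) * ((u2 - l) * (u3 - l))) by ring.
  repeat apply Rmult_lt_0_compat; lra.
Qed.

Lemma period_pullback (a b c x : R) : 0 < a -> a < x < b -> b < c ->
  a * b / (2 * x * sqrt (a * b * ((b - x) * (x - a))))
    * (2 * period_integrand a b c (cycle_angle a b x))
  = x / sqrt (Rpol 0 a b c x).
Proof.
  intros Ha Hx Hc.
  assert (Hab : 0 < a * b) by (apply Rmult_lt_0_compat; lra).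
  assert (Hrad : 0 < a * b * ((b - x) * (x - a))) by (repeat apply Rmult_lt_0_compat; lra).
  pose proof (Rpol_pos 0 a b c x ltac:(lra) Hx Hc) as Hpol.
  unfold period_integrand; rewrite quad_cycle_angle by lra.
  replace (c * (a * b / x) - a * b)
    with ((a * b / x) ^ 2 * Rpol 0 a b c x / (a * b * ((b - x) * (x - a))))
    by (unfold Rpol; field; lra).
  assert (0 < a * b / x) by (apply Rdiv_lt_0_compat; lra).
  rewrite sqrt_div_alt, (sqrt_mult_alt ((a * b / x) ^ 2)), sqrt_pow2
    by (lra || apply pow2_ge_0).
  pose proof (sqrt_lt_R0 _ Hrad); pose proof (sqrt_lt_R0 _ Hpol).
  field; lra.
Qed.

Lemma continuous_abelian_integrand (nu u1 u2 u3 l : R) : - nu < u1 -> u1 < l < u2 -> u2 < u3 ->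
  continuous (fun l => (l + nu) / sqrt (Rpol nu u1 u2 u3 l)) l.
Proof.
  intros Hu1 Hl Hu3; apply (continuous_mult (K := R_AbsRing)); [continuous_by_derivation|].
  apply continuous_Rinv_comp; [|now apply Rgt_not_eq, sqrt_lt_R0, Rpol_pos].
  apply continuous_sqrt_comp; unfold Rpol; continuous_by_derivation.
Qed.

Lemma is_RInt_gen_period (nu u1 u2 u3 : R) : - nu < u1 -> u1 < u2 -> u2 < u3 ->
  is_RInt_gen (fun l => (l + nu) / sqrt (Rpol nu u1 u2 u3 l)) (at_right u1) (at_left u2)
    (2 * period (u1 + nu) (u2 + nu) (u3 + nu)).
Proof.
  intros Hu1 Hu2 Hu3; set (a := u1 + nu); set (b := u2 + nu); set (c := u3 + nu).
  assert (Ha : 0 < a) by (unfold a; lra); assert (Hb : a < b) by (unfold a, b; lra).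
  assert (Hc : b < c) by (unfold b, c; lra).
  assert (Hangle : forall l, u1 <= l <= u2 -> continuous (fun l => cycle_angle a b (l + nu)) l).
  { intros l Hl; apply (continuous_comp (fun l => l + nu) (cycle_angle a b));
      [continuous_by_derivation|].
    apply continuous_cycle_angle; unfold a, b in *; lra. }
  unfold period; rewrite <- RInt_Rmult by now apply ex_RInt_period.
  rewrite <- (cycle_angle_left a b), <- (cycle_angle_right a b) by assumption.
  apply (is_RInt_gen_subst _ _ (fun l => cycle_angle a b (l + nu))
    (fun l => a * b / (2 * (l + nu) * sqrt (a * b * ((b - (l + nu)) * (l + nu - a)))))).
  - exact Hu2.
  - intros t; apply (continuous_mult (K := R_AbsRing)); [apply continuous_const|].
    now apply continuous_period_integrand.
  - intros l Hl; now apply continuous_abelian_integrand.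
  - intros l Hl; rewrite <- (Rmult_1_l (_ / _)).
    apply (is_derive_comp (V := R_NormedModule) (cycle_angle a b) (fun l => l + nu));
      [|auto_derive; trivial].
    apply is_derive_cycle_angle; unfold a, b in *; lra.
  - intros l Hl; rewrite period_pullback by (unfold a, b in *; lra).
    do 2 f_equal; unfold Rpol, a, b, c; ring.
  - apply Hangle; lra.
  - apply Hangle; lra.
Qed.

Lemma aper_period (nu u1 u2 u3 : R) : - nu < u1 -> u1 < u2 -> u2 < u3 ->
  aper nu u1 u2 u3 = 4 * period (u1 + nu) (u2 + nu) (u3 + nu).
Proof.
  intros Hu1 Hu2 Hu3; unfold aper.
  rewrite (is_RInt_gen_unique (V := R_CompleteNormedModule) _ _
             (is_RInt_gen_period nu u1 u2 u3 Hu1 Hu2 Hu3)).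
  ring.
Qed.

(* [s ^ 2] and [rho ^ 2] as functions of the shifted branch points [a = u1 + nu],
   [b = u2 + nu] and [c = u3 + nu]. *)
Definition ell_param (a b c : R) : R := c * (b - a) / (b * (c - a)).
Definition ell_char (a b : R) : R := (b - a) / b.

Section LegendreForm.

Variables a b c : R.
Hypotheses (a_pos : 0 < a) (a_lt_b : a < b) (b_lt_c : b < c).

Lemma ell_char_compl : 1 - ell_char a b = a / b.
Proof. unfold ell_char; field; lra. Qed.

Lemma ell_char_bounds : 0 <= ell_char a b < 1.
Proof.
  split; [apply Rdiv_le_0_compat; lra|].
  enough (0 < 1 - ell_char a b) by lra.
  rewrite ell_char_compl; apply Rdiv_lt_0_compat; lra.
Qed.

Lemma ell_param_compl : 1 - ell_param a b c = a * (c - b) / (b * (c - a)).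
Proof. unfold ell_param; field; lra. Qed.

Lemma ell_param_bounds : 0 <= ell_param a b c < 1.
Proof.
  split; [apply Rdiv_le_0_compat; [apply Rmult_le_pos|apply Rmult_lt_0_compat]; lra|].
  enough (0 < 1 - ell_param a b c) by lra.
  rewrite ell_param_compl; apply Rdiv_lt_0_compat; apply Rmult_lt_0_compat; lra.
Qed.

Lemma quad_ba_char (t : R) : quad b a t = b * (1 - ell_char a b * sin t ^ 2).
Proof. unfold quad, ell_char; rewrite cos_sq; field; lra. Qed.

Lemma sqrt_period_radicand (t : R) :
  sqrt (c * quad b a t - a * b) = sqrt (b * (c - a)) * ellDelta (ell_param a b c) t.
Proof.
  unfold ellDelta; rewrite <- sqrt_mult_alt by (apply Rmult_le_pos; lra).
  f_equal; unfold quad, ell_param; rewrite cos_sq; field; lra.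
Qed.

Lemma period_scale_pos : 0 < sqrt (b * (c - a)).
Proof. apply sqrt_lt_R0, Rmult_lt_0_compat; lra. Qed.

Lemma period_ellPi :
  period a b c = a / sqrt (b * (c - a)) * ellPi (ell_char a b) (ell_param a b c).
Proof.
  pose proof ell_char_bounds as Hn; pose proof ell_param_bounds as Hm; pose proof period_scale_pos.
  unfold ellPi, ell_RInt; rewrite <- RInt_Rmult.
  - apply RInt_ext_R; [exact PI2_nonneg|]; intros t _; unfold period_integrand.
    rewrite sqrt_period_radicand, quad_ba_char.
    pose proof (ellDelta_pos (ell_param a b c) ltac:(lra) t).
    pose proof (one_minus_sin_sq_pos (ell_char a b) t ltac:(lra)); field; lra.
  - apply ex_ell_RInt; [lra|]; intros t; apply continuous_inv_one_minus_sin_sq; lra.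
Qed.

Lemma period_pos : 0 < period a b c.
Proof.
  rewrite period_ellPi; apply Rmult_lt_0_compat.
  - apply Rdiv_lt_0_compat; [exact a_pos|exact period_scale_pos].
  - apply ellPi_pos; [exact ell_char_bounds|exact ell_param_bounds].
Qed.

Lemma RInt_trig_weight_period (x y : R) :
  RInt (fun t => (x * sin t ^ 2 + y * cos t ^ 2) / sqrt (c * quad b a t - a * b)) 0 (PI / 2)
  = (x * ellD (ell_param a b c) + y * ellB (ell_param a b c)) / sqrt (b * (c - a)) :> R.
Proof.
  pose proof ell_param_bounds as Hm; pose proof period_scale_pos.
  set (m := ell_param a b c) in *; set (scale := sqrt (b * (c - a))) in *.
  transitivity (ell_RInt m (fun t => x / scale * sin t ^ 2 + y / scale * cos t ^ 2)).
  - apply RInt_ext_R; [exact PI2_nonneg|]; intros t _.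
    rewrite sqrt_period_radicand; fold m scale.
    pose proof (ellDelta_pos m ltac:(lra) t); field; lra.
  - rewrite (ell_RInt_linear m ltac:(lra) (fun t => sin t ^ 2) (fun t => cos t ^ 2) _
               (x / scale) (y / scale) continuous_sin_sq continuous_cos_sq) by reflexivity.
    fold (ellD m) (ellB m); field; lra.
Qed.

End LegendreForm.

(** * Variation of the period *)

Lemma continuity_2d_pt_snd (f : R -> R -> R) (x y : R) :
  continuity_2d_pt f x y -> continuous (f x) y.
Proof.
  intros Hf; apply filterlim_locally; intros eps; destruct (Hf eps) as [d Hd].
  exists d; intros z Hz; apply Hd; [|exact Hz].
  rewrite Rminus_diag, Rabs_R0; apply cond_pos.
Qed.

Lemma is_derive_RInt_param_exact (f df : R -> R -> R) (g G : R -> R) (a b x : R) : a <= b ->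
  locally x (fun y => forall t, is_derive (fun z => f z t) y (df y t)) ->
  (forall t, continuity_2d_pt df x t) ->
  locally x (fun y => ex_RInt (f y) a b) ->
  (forall t, is_derive G t (df x t - g t)) -> (forall t, continuous g t) -> G a = G b ->
  is_derive (fun y => RInt (f y) a b) x (RInt g a b).
Proof.
  intros Hab Hf Hdf Hint HG Hg HGab.
  assert (Hcont : forall t, continuous (df x) t)
    by (intros t; apply continuity_2d_pt_snd, Hdf).
  assert (Hexact : forall t, continuous (fun t => df x t - g t) t)
    by (intros t; now apply (continuous_minus (V := R_NormedModule))).
  assert (Hvalue : RInt (fun t => Derive (fun z => f z t) x) a b = RInt g a b :> R).
  { transitivity (RInt (fun t => 1 * g t + 1 * (df x t - g t)) a b).
    - apply RInt_ext_R; [exact Hab|]; intros t _.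
      transitivity (df x t); [apply is_derive_unique, (locally_singleton _ _ Hf)|ring].
    - rewrite RInt_linear by (apply ex_RInt_continuous_R; assumption).
      rewrite (RInt_primitive G (fun t => df x t - g t) a b Hab) by auto.
      rewrite HGab; ring. }
  rewrite <- Hvalue; apply (is_derive_RInt_param f).
  - revert Hf; apply filter_imp; intros y Hy t _; eexists; apply Hy.
  - intros t _; apply (continuity_2d_pt_ext_loc df); [|apply Hdf].
    destruct Hf as [e He]; exists e; intros y z Hy _.
    symmetry; apply is_derive_unique, He, Hy.
  - exact Hint.
Qed.

Lemma continuity_2d_pt_of_continuous (f : R -> R) (x t : R) : continuous f x ->
  continuity_2d_pt (fun y _ => f y) x t.
Proof.
  intros Hf; apply (continuity_1d_2d_pt_comp f (fun y _ => y));
    [now apply continuity_pt_filterlim|apply continuity_2d_pt_id1].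
Qed.

Ltac continuity_2d_step :=
  first
    [ assumption | apply continuity_2d_pt_plus | apply continuity_2d_pt_opp
    | apply continuity_2d_pt_mult | apply continuity_2d_pt_inv | apply continuity_2d_pt_const
    | apply continuity_2d_pt_id2
    | apply (continuity_1d_2d_pt_comp sqrt); [apply continuity_pt_sqrt | ]
    | apply (continuity_1d_2d_pt_comp cos); [apply continuity_cos | ]
    | apply (continuity_1d_2d_pt_comp sin); [apply continuity_sin | ]
    | apply continuity_2d_pt_of_continuous ].

Definition deriv_div_sqrt (N W Y n w y : R) : R :=
  (n / W - N * w / W ^ 2 - N * y / (2 * W * Y)) / sqrt Y.

Lemma is_derive_div_sqrt (N W Y : R -> R) (x n w y : R) :
  is_derive N x n -> is_derive W x w -> is_derive Y x y -> W x <> 0 -> 0 < Y x ->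
  is_derive (fun z => N z / (W z * sqrt (Y z))) x (deriv_div_sqrt (N x) (W x) (Y x) n w y).
Proof.
  intros HN HW HY HWx HYx; pose proof (sqrt_lt_R0 _ HYx) as Hroot.
  unfold deriv_div_sqrt; evar_last.
  - apply (is_derive_div N (fun z => W z * sqrt (Y z))); [exact HN| |nra].
    apply (is_derive_mult W (fun z => sqrt (Y z)) x w (y / (2 * sqrt (Y x)))); [exact HW| |].
    + now apply is_derive_sqrt.
    + intros; apply Rmult_comm.
  - unfold plus, mult; simpl.
    set (r := sqrt (Y x)) in *; rewrite <- (sqrt_sqrt (Y x)) by lra; fold r.
    field; lra.
Qed.

Lemma continuity_2d_pt_deriv_div_sqrt (N W Y n w y : R -> R -> R) (u v : R) :
  continuity_2d_pt N u v -> continuity_2d_pt W u v -> continuity_2d_pt Y u v ->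
  continuity_2d_pt n u v -> continuity_2d_pt w u v -> continuity_2d_pt y u v ->
  W u v <> 0 -> 0 < Y u v ->
  continuity_2d_pt
    (fun z t => deriv_div_sqrt (N z t) (W z t) (Y z t) (n z t) (w z t) (y z t)) u v.
Proof.
  intros HN HW HY Hn Hw Hy HW0 HY0; pose proof (sqrt_lt_R0 _ HY0).
  unfold deriv_div_sqrt, Rdiv, Rminus, pow; repeat continuity_2d_step; nra.
Qed.

Lemma continuity_2d_pt_quad (p q : R -> R) (x t : R) : continuous p x -> continuous q x ->
  continuity_2d_pt (fun y t => quad (p y) (q y) t) x t.
Proof.
  intros Hp Hq; unfold quad, pow; repeat continuity_2d_step.
Qed.

Lemma is_derive_quad (p q : R -> R) (dp dq y t : R) : is_derive p y dp -> is_derive q y dq ->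
  is_derive (fun z => quad (p z) (q z) t) y (quad dp dq t).
Proof.
  intros Hp Hq; apply (is_derive_plus (V := R_NormedModule)).
  - apply (is_derive_ext (fun z => cos t ^ 2 * p z)); [intros z; apply Rmult_comm|].
    rewrite Rmult_comm; now apply is_derive_scal.
  - apply (is_derive_ext (fun z => sin t ^ 2 * q z)); [intros z; apply Rmult_comm|].
    rewrite Rmult_comm; now apply is_derive_scal.
Qed.

Definition endpoint_rate (c dc x dx : R) : R := (c * dx - x * dc) / (2 * (c - x)).

(* Its derivative, the part of the variation of [period_integrand] that is not a combination of
   the integrands of [ellD] and [ellB], integrates to zero. *)
Definition period_flux (a b c da db dc t : R) : R :=
  sin t * cos t
    * ((da * b - a * db) / 2 + (endpoint_rate c dc a da - endpoint_rate c dc b db) * quad b a t)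
  / (quad b a t * sqrt (c * quad b a t - a * b)).

Lemma period_flux_0 (a b c da db dc : R) : period_flux a b c da db dc 0 = 0.
Proof. unfold period_flux; rewrite sin_0; unfold Rdiv; ring. Qed.

Lemma period_flux_PI2 (a b c da db dc : R) : period_flux a b c da db dc (PI / 2) = 0.
Proof. unfold period_flux; rewrite cos_PI2; unfold Rdiv; ring. Qed.

Lemma is_derive_period_flux (a b c da db dc t : R) : 0 < a -> a < b -> b < c ->
  is_derive (period_flux a b c da db dc) t
    (deriv_div_sqrt (a * b) (quad b a t) (c * quad b a t - a * b) (da * b + a * db)
       (quad db da t) (dc * quad b a t + c * quad db da t - (da * b + a * db))
     - (endpoint_rate c dc a da * sin t ^ 2 + endpoint_rate c dc b db * cos t ^ 2)
       / sqrt (c * quad b a t - a * b)).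
Proof.
  intros Ha Hb Hc.
  set (rate_a := endpoint_rate c dc a da); set (rate_b := endpoint_rate c dc b db).
  pose proof (quad_ba_bounds a b Hb t); pose proof (period_radicand_pos a b c Ha Hb Hc t) as Hrad.
  pose proof (sqrt_lt_R0 _ Hrad).
  assert (HW : is_derive (quad b a) t (2 * (a - b) * sin t * cos t))
    by (unfold quad; auto_derive; [trivial|ring]).
  evar_last.
  - apply (is_derive_div_sqrt
      (fun t => sin t * cos t * ((da * b - a * db) / 2 + (rate_a - rate_b) * quad b a t))
      (quad b a) (fun t => c * quad b a t - a * b) t
      ((cos t ^ 2 - sin t ^ 2) * ((da * b - a * db) / 2 + (rate_a - rate_b) * quad b a t)
       + sin t * cos t * (rate_a - rate_b) * (2 * (a - b) * sin t * cos t))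
      (2 * (a - b) * sin t * cos t) (c * (2 * (a - b) * sin t * cos t))).
    + unfold quad; auto_derive; [trivial|ring].
    + exact HW.
    + unfold quad; auto_derive; [trivial|ring].
    + lra.
    + exact Hrad.
  - unfold deriv_div_sqrt, rate_a, rate_b, endpoint_rate.
    pose proof (cos_sq t) as Hcos; set (root := sqrt _) in *; clearbody root; unfold quad in *.
    field [Hcos]; lra.
Qed.

Lemma locally_lt (f g : R -> R) (x : R) : continuous f x -> continuous g x -> f x < g x ->
  locally x (fun y => f y < g y).
Proof.
  intros Hf Hg Hlt.
  assert (Hpos : locally x (fun y => 0 < g y - f y)).
  { apply (continuous_minus (V := R_NormedModule) g f x Hg Hf).
    apply (open_gt 0); unfold minus, plus, opp; simpl; lra. }
  revert Hpos; apply filter_imp; intros y; lra.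
Qed.

Definition period_rate (a b c da db dc : R) : R :=
  endpoint_rate c dc a da * ellD (ell_param a b c)
  + endpoint_rate c dc b db * ellB (ell_param a b c).

Section CurveDerivative.

Variables A B C A' B' C' : R -> R.
Hypotheses (A_deriv : forall y, is_derive A y (A' y)) (B_deriv : forall y, is_derive B y (B' y))
  (C_deriv : forall y, is_derive C y (C' y)).

Let dN (y : R) : R := A' y * B y + A y * B' y.
Let dY (y t : R) : R := C' y * quad (B y) (A y) t + C y * quad (B' y) (A' y) t - dN y.

Definition dperiod_integrand (y t : R) : R :=
  deriv_div_sqrt (A y * B y) (quad (B y) (A y) t) (C y * quad (B y) (A y) t - A y * B y)
    (dN y) (quad (B' y) (A' y) t) (dY y t).

Lemma is_derive_period_integrand (y t : R) : 0 < A y -> A y < B y -> B y < C y ->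
  is_derive (fun z => period_integrand (A z) (B z) (C z) t) y (dperiod_integrand y t).
Proof.
  intros Ha Hb Hc.
  assert (HN : is_derive (fun z => A z * B z) y (dN y)).
  { exact (is_derive_mult A B y _ _ (A_deriv y) (B_deriv y) Rmult_comm). }
  assert (HW : is_derive (fun z => quad (B z) (A z) t) y (quad (B' y) (A' y) t)).
  { apply is_derive_quad; [apply B_deriv|apply A_deriv]. }
  apply (is_derive_div_sqrt (fun z => A z * B z) (fun z => quad (B z) (A z) t)
           (fun z => C z * quad (B z) (A z) t - A z * B z)); trivial.
  - apply (is_derive_minus (V := R_NormedModule)); [|exact HN].
    exact (is_derive_mult C _ y _ _ (C_deriv y) HW Rmult_comm).
  - generalize (quad_ba_bounds (A y) (B y) Hb t); lra.
  - now apply period_radicand_pos.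
Qed.

Lemma continuity_2d_pt_dperiod_integrand (x t : R) :
  continuous A' x -> continuous B' x -> continuous C' x ->
  0 < A x -> A x < B x -> B x < C x -> continuity_2d_pt dperiod_integrand x t.
Proof.
  intros HA' HB' HC' Ha Hb Hc.
  assert (HA : continuous A x) by (apply continuous_of_derivable; eexists; apply A_deriv).
  assert (HB : continuous B x) by (apply continuous_of_derivable; eexists; apply B_deriv).
  assert (HC : continuous C x) by (apply continuous_of_derivable; eexists; apply C_deriv).
  pose proof (quad_ba_bounds (A x) (B x) Hb t).
  pose proof (period_radicand_pos (A x) (B x) (C x) Ha Hb Hc t).
  apply continuity_2d_pt_deriv_div_sqrt; unfold dY, dN, Rminus;
    repeat first [apply continuity_2d_pt_quad | continuity_2d_step]; lra.
Qed.

Lemma locally_ordered (x : R) : 0 < A x -> A x < B x -> B x < C x ->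
  locally x (fun y => 0 < A y /\ A y < B y /\ B y < C y).
Proof.
  intros Ha Hb Hc.
  repeat apply filter_and; apply locally_lt; trivial using continuous_const;
    apply continuous_of_derivable; eexists; trivial.
Qed.

Lemma is_derive_period (x : R) :
  continuous A' x -> continuous B' x -> continuous C' x ->
  0 < A x -> A x < B x -> B x < C x ->
  is_derive (fun y => period (A y) (B y) (C y)) x
    (period_rate (A x) (B x) (C x) (A' x) (B' x) (C' x) / sqrt (B x * (C x - A x))).
Proof.
  intros HA' HB' HC' Ha Hb Hc.
  pose proof (locally_ordered x Ha Hb Hc) as Hordered.
  unfold period_rate; rewrite <- RInt_trig_weight_period by assumption.
  apply (is_derive_RInt_param_exact _ dperiod_integrand _
           (period_flux (A x) (B x) (C x) (A' x) (B' x) (C' x))).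
  - exact PI2_nonneg.
  - revert Hordered; apply filter_imp; intros y Hy t; now apply is_derive_period_integrand.
  - intros t; now apply continuity_2d_pt_dperiod_integrand.
  - revert Hordered; apply filter_imp; intros y Hy; now apply ex_RInt_period.
  - intros t; now apply is_derive_period_flux.
  - intros t; apply (continuous_mult (K := R_AbsRing)); [continuous_by_derivation|].
    now apply continuous_inv_period_root.
  - now rewrite period_flux_0, period_flux_PI2.
Qed.

End CurveDerivative.

(** * Characteristic speeds *)

Definition regular_speed (k omega : R -> R) (x : R) : Prop :=
  ex_derive k x /\ ex_derive omega x /\ Derive k x <> 0.

Lemma Derive_ratio_inverse_period (P S k omega : R -> R) (kappa x dP dS : R) :
  kappa <> 0 -> P x <> 0 -> dP <> 0 -> is_derive P x dP -> is_derive S x dS ->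
  locally x (fun y => k y = kappa / P y) -> (forall y, omega y = S y * k y) ->
  regular_speed k omega x /\ Derive omega x / Derive k x = S x - dS * (P x / dP).
Proof.
  intros Hkappa HPx HdP HP HS Hk Homega.
  assert (dk : is_derive k x (- (kappa * dP) / P x ^ 2)).
  { apply (is_derive_ext_loc (fun y => kappa / P y)).
    - revert Hk; apply filter_imp; intros y Hy; now symmetry.
    - evar_last; [apply (is_derive_div (fun _ => kappa) P);
                  [apply is_derive_const|exact HP|exact HPx]|].
      unfold zero; simpl; field; exact HPx. }
  assert (domega : is_derive omega x (dS * k x + S x * (- (kappa * dP) / P x ^ 2))).
  { apply (is_derive_ext (fun y => S y * k y)); [intros y; symmetry; apply Homega|].
    exact (is_derive_mult S k x _ _ HS dk Rmult_comm). }
  assert (Hdk : - (kappa * dP) / P x ^ 2 <> 0).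
  { apply Rmult_integral_contrapositive_currified;
      [apply Ropp_neq_0_compat, Rmult_integral_contrapositive_currified; assumption|].
    apply Rinv_neq_0_compat, pow_nonzero, HPx. }
  unfold regular_speed; rewrite (is_derive_unique _ _ _ dk), (is_derive_unique _ _ _ domega).
  repeat split; trivial.
  - eexists; exact dk.
  - eexists; exact domega.
  - rewrite (locally_singleton _ _ Hk); field; auto.
Qed.

Lemma kwave_period (nu u1 u2 u3 : R) : - nu < u1 -> u1 < u2 -> u2 < u3 ->
  kwave nu u1 u2 u3 = PI / 2 / period (u1 + nu) (u2 + nu) (u3 + nu).
Proof.
  intros Hu1 Hu2 Hu3; unfold kwave; rewrite aper_period by assumption; unfold Rdiv.
  rewrite Rinv_mult; lra.
Qed.

Lemma is_derive_add_const (f df : R -> R) (k : R) : (forall y, is_derive f y (df y)) ->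
  forall y, is_derive (fun y => f y + k) y (df y).
Proof.
  intros Hf y; rewrite <- (Rplus_0_r (df y)).
  apply (is_derive_plus (V := R_NormedModule) f); [apply Hf|].
  exact (is_derive_const (V := R_NormedModule) k y).
Qed.

Section CurveSpeed.

Variables (nu x : R) (U1 U2 U3 dU1 dU2 dU3 : R -> R).
Hypotheses (U1_deriv : forall y, is_derive U1 y (dU1 y))
  (U2_deriv : forall y, is_derive U2 y (dU2 y)) (U3_deriv : forall y, is_derive U3 y (dU3 y)).
Hypotheses (dU1_cont : continuous dU1 x) (dU2_cont : continuous dU2 x)
  (dU3_cont : continuous dU3 x).
Hypotheses (nu_lt_U1 : - nu < U1 x) (U1_lt_U2 : U1 x < U2 x) (U2_lt_U3 : U2 x < U3 x).

Let a : R := U1 x + nu.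
Let b : R := U2 x + nu.
Let c : R := U3 x + nu.

Lemma locally_kwave_period : locally x (fun y =>
  kwave nu (U1 y) (U2 y) (U3 y) = PI / 2 / period (U1 y + nu) (U2 y + nu) (U3 y + nu)).
Proof.
  generalize (locally_ordered _ _ _ _ _ _ (is_derive_add_const _ _ nu U1_deriv)
    (is_derive_add_const _ _ nu U2_deriv) (is_derive_add_const _ _ nu U3_deriv) x
    ltac:(lra) ltac:(lra) ltac:(lra)).
  apply filter_imp; intros y Hy; apply kwave_period; lra.
Qed.

Lemma is_derive_shifted_period :
  is_derive (fun y => period (U1 y + nu) (U2 y + nu) (U3 y + nu)) x
    (period_rate a b c (dU1 x) (dU2 x) (dU3 x) / sqrt (b * (c - a))).
Proof.
  apply (is_derive_period (fun y => U1 y + nu) (fun y => U2 y + nu) (fun y => U3 y + nu));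
    try apply is_derive_add_const; trivial; lra.
Qed.

Lemma is_derive_phase_velocity :
  is_derive (fun y => U1 y + U2 y + U3 y + 2 * nu) x (dU1 x + dU2 x + dU3 x).
Proof.
  apply (is_derive_add_const (fun y => U1 y + U2 y + U3 y) (fun y => dU1 y + dU2 y + dU3 y)).
  intros y; apply (is_derive_plus (V := R_NormedModule)); [|apply U3_deriv].
  apply (is_derive_plus (V := R_NormedModule)); [apply U1_deriv|apply U2_deriv].
Qed.

Lemma speed_along_curve :
  let rate := period_rate a b c (dU1 x) (dU2 x) (dU3 x) in
  let k := fun y => kwave nu (U1 y) (U2 y) (U3 y) in
  let om := fun y => omega nu (U1 y) (U2 y) (U3 y) in
  rate <> 0 ->
  regular_speed k om x /\
  Derive om x / Derive k x
  = U1 x + U2 x + U3 x + 2 * nu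
    - (dU1 x + dU2 x + dU3 x) * (a * ellPi (ell_char a b) (ell_param a b c) / rate).
Proof.
  intros rate k om Hrate.
  assert (Ha : 0 < a) by (unfold a; lra); assert (Hb : a < b) by (unfold a, b; lra).
  assert (Hc : b < c) by (unfold b, c; lra).
  pose proof (period_scale_pos a b c Ha Hb Hc) as Hscale.
  pose proof (period_pos a b c Ha Hb Hc) as Hpos.
  destruct (Derive_ratio_inverse_period
    (fun y => period (U1 y + nu) (U2 y + nu) (U3 y + nu))
    (fun y => U1 y + U2 y + U3 y + 2 * nu) k om (PI / 2) x
    (rate / sqrt (b * (c - a))) (dU1 x + dU2 x + dU3 x)) as [Hreg Hratio].
  - generalize PI2_RGT_0; lra.
  - fold a b c; lra.
  - apply Rmult_integral_contrapositive_currified; [exact Hrate|].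
    apply Rinv_neq_0_compat; lra.
  - apply is_derive_shifted_period.
  - apply is_derive_phase_velocity.
  - apply locally_kwave_period.
  - intros y; unfold om, k, omega; ring.
  - split; [exact Hreg|]; rewrite Hratio; fold a b c.
    rewrite period_ellPi by assumption; field; lra.
Qed.

End CurveSpeed.

Definition correction_size (a b c gap scale w : R) : R :=
  2 * a * gap * ellPi (ell_char a b) (ell_param a b c) / (scale * w).

Definition speed_correction1 (a b c : R) : R :=
  - correction_size a b c (c - a) c (ellD (ell_param a b c)).
Definition speed_correction2 (a b c : R) : R :=
  - correction_size a b c (c - b) c (ellB (ell_param a b c)).
Definition speed_correction3 (a b c : R) : R :=
  correction_size a b c (c - b) b (ellE (ell_param a b c)).

Section Corrections.

Variables a b c : R.
Hypotheses (a_pos : 0 < a) (a_lt_b : a < b) (b_lt_c : b < c).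

Let m : R := ell_param a b c.
Let n : R := ell_char a b.
Let m_bounds : 0 <= m < 1 := ell_param_bounds a b c a_pos a_lt_b b_lt_c.
Let n_bounds : 0 <= n < 1 := ell_char_bounds a b a_pos a_lt_b.

Lemma period_rate_1 : period_rate a b c 1 0 0 = c * ellD m / (2 * (c - a)).
Proof. unfold period_rate, endpoint_rate; fold m; field; lra. Qed.

Lemma period_rate_2 : period_rate a b c 0 1 0 = c * ellB m / (2 * (c - b)).
Proof. unfold period_rate, endpoint_rate; fold m; field; lra. Qed.

Lemma period_rate_3 : period_rate a b c 0 0 1 = - (b * ellE m / (2 * (c - b))).
Proof.
  rewrite ellE_eq by apply m_bounds; unfold m; rewrite ell_param_compl by assumption.
  unfold period_rate, endpoint_rate; field; lra.
Qed.

Lemma correction_size_pos (gap scale w : R) : 0 < gap -> 0 < scale -> 0 < w ->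
  0 < correction_size a b c gap scale w.
Proof.
  intros Hgap Hscale Hw; pose proof (ellPi_pos n m n_bounds m_bounds).
  apply Rdiv_lt_0_compat; repeat apply Rmult_lt_0_compat; trivial; lra.
Qed.

Lemma speed_correction1_neg : speed_correction1 a b c < 0.
Proof.
  apply Ropp_lt_gt_0_contravar, correction_size_pos; [lra|lra|apply ellD_pos, m_bounds].
Qed.

Lemma speed_correction2_neg : speed_correction2 a b c < 0.
Proof.
  apply Ropp_lt_gt_0_contravar, correction_size_pos; [lra|lra|apply ellB_pos, m_bounds].
Qed.

Lemma speed_correction3_pos : 0 < speed_correction3 a b c.
Proof. apply correction_size_pos; [lra|lra|apply ellE_pos, m_bounds]. Qed.

(* [K - E = m D] *)
Lemma speed_correction1_KE :
  speed_correction1 a b c = 2 * a * (a - b) * ellPi n m / (b * (ellK m - ellE m)).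
Proof.
  pose proof (ellD_pos m m_bounds).
  replace (ellK m - ellE m) with (m * ellD m)
    by (rewrite ellK_eq, ellE_eq by apply m_bounds; ring).
  unfold speed_correction1, correction_size; fold m n; set (D := ellD m) in *; clearbody D.
  unfold m, ell_param; field; lra.
Qed.

(* [(1 - m) K - E = - m B] *)
Lemma speed_correction2_KE :
  speed_correction2 a b c
  = 2 * (b - a) * ellPi n m / (ellK m - b * (c - a) / (a * (c - b)) * ellE m).
Proof.
  pose proof (ellB_pos m m_bounds).
  replace (ellK m - _) with (- (c * (b - a) / (a * (c - b)) * ellB m)).
  2: { rewrite ellK_eq, ellE_eq by apply m_bounds.
       replace (1 - m) with (a * (c - b) / (b * (c - a))) by (symmetry; now apply ell_param_compl).
       field; lra. }
  unfold speed_correction2, correction_size; fold m n; field; lra.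
Qed.

End Corrections.

Section Speeds.

Variables nu u1 u2 u3 : R.
Hypotheses (nu_lt_u1 : - nu < u1) (u1_lt_u2 : u1 < u2) (u2_lt_u3 : u2 < u3).

Let a : R := u1 + nu.
Let b : R := u2 + nu.
Let c : R := u3 + nu.

Lemma shifted_ordered : 0 < a /\ a < b /\ b < c.
Proof. unfold a, b, c; lra. Qed.

Lemma Cspeed1_eq :
  regular_speed (fun x => kwave nu x u2 u3) (fun x => omega nu x u2 u3) u1 /\
  Cspeed1 nu u1 u2 u3 = u1 + u2 + u3 + 2 * nu + speed_correction1 a b c.
Proof.
  destruct shifted_ordered as (Ha & Hb & Hc).
  pose proof (ellD_pos _ (ell_param_bounds a b c Ha Hb Hc)).
  destruct (speed_along_curve nu u1 (fun x => x) (fun _ => u2) (fun _ => u3)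
    (fun _ => 1) (fun _ => 0) (fun _ => 0)) as [Hreg Hspeed];
    try apply continuous_const; try (intros y; auto_derive; reflexivity);
    trivial; cbv beta; fold a b c.
  - rewrite period_rate_1 by assumption.
    apply Rgt_not_eq, Rdiv_lt_0_compat; [apply Rmult_lt_0_compat|]; lra.
  - split; [exact Hreg|]; unfold Cspeed1; rewrite Hspeed; fold a b c.
    rewrite period_rate_1 by assumption; unfold speed_correction1, correction_size; field; lra.
Qed.

Lemma Cspeed2_eq :
  regular_speed (fun x => kwave nu u1 x u3) (fun x => omega nu u1 x u3) u2 /\
  Cspeed2 nu u1 u2 u3 = u1 + u2 + u3 + 2 * nu + speed_correction2 a b c.
Proof.
  destruct shifted_ordered as (Ha & Hb & Hc).
  pose proof (ellB_pos _ (ell_param_bounds a b c Ha Hb Hc)).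
  destruct (speed_along_curve nu u2 (fun _ => u1) (fun x => x) (fun _ => u3)
    (fun _ => 0) (fun _ => 1) (fun _ => 0)) as [Hreg Hspeed];
    try apply continuous_const; try (intros y; auto_derive; reflexivity);
    trivial; cbv beta; fold a b c.
  - rewrite period_rate_2 by assumption.
    apply Rgt_not_eq, Rdiv_lt_0_compat; [apply Rmult_lt_0_compat|]; lra.
  - split; [exact Hreg|]; unfold Cspeed2; rewrite Hspeed; fold a b c.
    rewrite period_rate_2 by assumption; unfold speed_correction2, correction_size; field; lra.
Qed.

Lemma Cspeed3_eq :
  regular_speed (fun x => kwave nu u1 u2 x) (fun x => omega nu u1 u2 x) u3 /\
  Cspeed3 nu u1 u2 u3 = u1 + u2 + u3 + 2 * nu + speed_correction3 a b c.
Proof.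
  destruct shifted_ordered as (Ha & Hb & Hc).
  pose proof (ellE_pos _ (ell_param_bounds a b c Ha Hb Hc)).
  destruct (speed_along_curve nu u3 (fun _ => u1) (fun _ => u2) (fun x => x)
    (fun _ => 0) (fun _ => 0) (fun _ => 1)) as [Hreg Hspeed];
    try apply continuous_const; try (intros y; auto_derive; reflexivity);
    trivial; cbv beta; fold a b c.
  - rewrite period_rate_3 by assumption.
    apply Ropp_neq_0_compat, Rgt_not_eq, Rdiv_lt_0_compat; [apply Rmult_lt_0_compat|]; lra.
  - split; [exact Hreg|]; unfold Cspeed3; rewrite Hspeed; fold a b c.
    rewrite period_rate_3 by assumption; unfold speed_correction3, correction_size; field; lra.
Qed.

Lemma Cspeed1_lt_Cspeed3 : Cspeed1 nu u1 u2 u3 < Cspeed3 nu u1 u2 u3.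
Proof.
  destruct shifted_ordered as (Ha & Hb & Hc).
  rewrite (proj2 Cspeed1_eq), (proj2 Cspeed3_eq).
  pose proof (speed_correction1_neg a b c Ha Hb Hc).
  pose proof (speed_correction3_pos a b c Ha Hb Hc); lra.
Qed.

Lemma Cspeed2_lt_Cspeed3 : Cspeed2 nu u1 u2 u3 < Cspeed3 nu u1 u2 u3.
Proof.
  destruct shifted_ordered as (Ha & Hb & Hc).
  rewrite (proj2 Cspeed2_eq), (proj2 Cspeed3_eq).
  pose proof (speed_correction2_neg a b c Ha Hb Hc).
  pose proof (speed_correction3_pos a b c Ha Hb Hc); lra.
Qed.

Lemma smod_sq : smod nu u1 u2 u3 ^ 2 = ell_param a b c.
Proof.
  destruct shifted_ordered as (Ha & Hb & Hc); pose proof (ell_param_bounds a b c Ha Hb Hc).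
  unfold smod; replace (_ / _) with (ell_param a b c)
    by (unfold ell_param, a, b, c; field; lra).
  apply pow2_sqrt; lra.
Qed.

Lemma rhop_sq : rhop nu u1 u2 ^ 2 = ell_char a b.
Proof.
  destruct shifted_ordered as (Ha & Hb & _); pose proof (ell_char_bounds a b Ha Hb).
  unfold rhop; replace (_ / _) with (ell_char a b) by (unfold ell_char, a, b; field; lra).
  apply pow2_sqrt; lra.
Qed.

Let s : R := smod nu u1 u2 u3.
Let rho : R := rhop nu u1 u2.

Lemma smod_sq_lt_1 : s ^ 2 < 1.
Proof.
  destruct shifted_ordered as (Ha & Hb & Hc); pose proof (ell_param_bounds a b c Ha Hb Hc).
  unfold s; rewrite smod_sq; lra.
Qed.

Lemma Kell_smod : Kell s = ellK (ell_param a b c).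
Proof. unfold s; rewrite Kell_ellK, smod_sq; reflexivity. Qed.

Lemma Eell_smod : Eell s = ellE (ell_param a b c).
Proof. rewrite Eell_ellE by exact smod_sq_lt_1; unfold s; rewrite smod_sq; reflexivity. Qed.

Lemma Lam_smod : Lam (Kell s) rho s = ellPi (ell_char a b) (ell_param a b c).
Proof.
  destruct shifted_ordered as (Ha & Hb & _); pose proof (ell_char_bounds a b Ha Hb).
  rewrite Lam_Kell by (exact smod_sq_lt_1 || unfold rho; rewrite rhop_sq; lra).
  unfold s, rho; rewrite smod_sq, rhop_sq; reflexivity.
Qed.

Lemma Cspeed1_formula :
  Cspeed1 nu u1 u2 u3 = u1 + u2 + u3 + 2 * nu
    + 2 * (u1 + nu) * (u1 - u2) * Lam (Kell s) rho s / ((u2 + nu) * (Kell s - Eell s)).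
Proof.
  destruct shifted_ordered as (Ha & Hb & Hc).
  rewrite (proj2 Cspeed1_eq), speed_correction1_KE by assumption.
  rewrite Lam_smod, Kell_smod, Eell_smod; fold a b.
  replace (u1 - u2) with (a - b) by (unfold a, b; ring); ring.
Qed.

Lemma Cspeed2_formula :
  Cspeed2 nu u1 u2 u3 = u1 + u2 + u3 + 2 * nu
    + 2 * (u2 - u1) * Lam (Kell s) rho s
      / (Kell s - (u2 + nu) * (u3 - u1) / ((u1 + nu) * (u3 - u2)) * Eell s).
Proof.
  destruct shifted_ordered as (Ha & Hb & Hc).
  rewrite (proj2 Cspeed2_eq), speed_correction2_KE by assumption.
  rewrite Lam_smod, Kell_smod, Eell_smod; fold a b.
  replace (u2 - u1) with (b - a) by (unfold a, b; ring).
  replace (u3 - u1) with (c - a) by (unfold a, c; ring).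
  replace (u3 - u2) with (c - b) by (unfold b, c; ring); ring.
Qed.

Lemma Cspeed3_formula :
  Cspeed3 nu u1 u2 u3 = u1 + u2 + u3 + 2 * nu
    + 2 * (u1 + nu) * (u3 - u2) * Lam (Kell s) rho s / ((u2 + nu) * Eell s).
Proof.
  rewrite (proj2 Cspeed3_eq), Lam_smod, Eell_smod.
  unfold speed_correction3, correction_size; fold a b.
  replace (u3 - u2) with (c - b) by (unfold b, c; ring); reflexivity.
Qed.

End Speeds.

(** * Limits of elliptic integrals *)

Definition tends {T : Type} (F : (T -> Prop) -> Prop) (f : T -> R) (l : R) : Prop :=
  filterlim f F (locally l).

Section Tends.

Context {T : Type} {F : (T -> Prop) -> Prop} {FF : Filter F}.
Implicit Types f g h : T -> R.

Lemma tends_const (k : R) : tends F (fun _ => k) k.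
Proof. apply filterlim_const. Qed.

Lemma tends_comp (h : R -> R) f (l : R) :
  continuous h l -> tends F f l -> tends F (fun x => h (f x)) (h l).
Proof. intros Hh Hf; exact (filterlim_comp _ _ _ f h F _ _ Hf Hh). Qed.

Lemma tends_plus f g (l k : R) :
  tends F f l -> tends F g k -> tends F (fun x => f x + g x) (l + k).
Proof.
  intros Hf Hg; exact (filterlim_comp_2 _ _ Rplus Hf Hg (filterlim_plus (V := R_NormedModule) l k)).
Qed.

Lemma tends_mult f g (l k : R) :
  tends F f l -> tends F g k -> tends F (fun x => f x * g x) (l * k).
Proof.
  intros Hf Hg; exact (filterlim_comp_2 _ _ Rmult Hf Hg (filterlim_mult (K := R_AbsRing) l k)).
Qed.

Lemma tends_add_const (k : R) f (l : R) : tends F f l -> tends F (fun x => f x + k) (l + k).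
Proof. intros Hf; apply tends_plus; [exact Hf|apply tends_const]. Qed.

Lemma tends_opp f (l : R) : tends F f l -> tends F (fun x => - f x) (- l).
Proof. apply (tends_comp Ropp); continuous_by_derivation. Qed.

Lemma tends_minus f g (l k : R) :
  tends F f l -> tends F g k -> tends F (fun x => f x - g x) (l - k).
Proof. intros Hf Hg; apply tends_plus; [exact Hf|now apply tends_opp]. Qed.

Lemma tends_inv f (l : R) : l <> 0 -> tends F f l -> tends F (fun x => / f x) (/ l).
Proof. intros Hl; now apply (tends_comp Rinv), continuous_Rinv. Qed.

Lemma tends_div f g (l k : R) :
  k <> 0 -> tends F f l -> tends F g k -> tends F (fun x => f x / g x) (l / k).
Proof. intros Hk Hf Hg; apply tends_mult; [exact Hf|now apply tends_inv]. Qed.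

Lemma tends_sqrt f (l : R) : tends F f l -> tends F (fun x => sqrt (f x)) (sqrt l).
Proof. apply (tends_comp sqrt), continuous_sqrt. Qed.

Lemma tends_eq f (l k : R) : tends F f l -> l = k -> tends F f k.
Proof. now intros Hf <-. Qed.

Lemma tends_ext f g (l : R) : F (fun x => f x = g x) -> tends F f l -> tends F g l.
Proof. apply filterlim_ext_loc. Qed.

Lemma tends_squeeze f g h (l : R) :
  F (fun x => f x <= g x <= h x) -> tends F f l -> tends F h l -> tends F g l.
Proof. apply (filterlim_le_le f g h l). Qed.

End Tends.

(* Leaves the nonvanishing of denominators, then the identification of the limit. *)
Ltac tends_rational :=
  eapply tends_eq;
  [ repeat first
      [ eassumption | apply tends_const | eapply tends_minus | eapply tends_plus
      | eapply tends_mult | eapply tends_div | eapply tends_inv | eapply tends_sqrt ]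
  | ].

Lemma tends_0_div {T : Type} {F : (T -> Prop) -> Prop} {FF : Filter F} (f g : T -> R) (delta : R) :
  0 < delta -> F (fun x => 0 <= f x /\ delta <= g x) -> tends F f 0 ->
  tends F (fun x => f x / g x) 0.
Proof.
  intros Hdelta Hfg Hf.
  apply (tends_squeeze (fun _ => 0) _ (fun x => f x * / delta)).
  - revert Hfg; apply filter_imp; intros x [Hfx Hgx]; split.
    + apply Rdiv_le_0_compat; lra.
    + apply Rmult_le_compat_l; [exact Hfx|now apply Rinv_le_contravar].
  - apply tends_const.
  - tends_rational; ring.
Qed.

Section EllipticLimits.

Context {T : Type} {F : (T -> Prop) -> Prop} {FF : Filter F}.
Variables n m : T -> R.
Hypothesis n_bounds : F (fun x => 0 <= n x < 1).
Hypothesis m_bounds : F (fun x => 0 <= m x < 1).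

Section ParameterTo0.

Hypothesis m_to_0 : tends F m 0.

Lemma tends_inv_sqrt_compl : tends F (fun x => / sqrt (1 - m x)) 1.
Proof. tends_rational; rewrite Rminus_0_r, sqrt_1; lra. Qed.

Lemma tends_ell_RInt (w : R -> R) : (forall t, continuous w t) -> (forall t, 0 <= w t) ->
  tends F (fun x => ell_RInt (m x) w) (RInt w 0 (PI / 2)).
Proof.
  intros Hw Hpos; pose proof tends_inv_sqrt_compl.
  apply (tends_squeeze (fun _ => RInt w 0 (PI / 2)) _
           (fun x => RInt w 0 (PI / 2) * / sqrt (1 - m x))).
  - revert m_bounds; apply filter_imp; intros x Hm; now apply ell_RInt_bounds.
  - apply tends_const.
  - tends_rational; ring.
Qed.

Lemma tends_ellB : tends F (fun x => ellB (m x)) (PI / 4).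
Proof.
  rewrite <- RInt_cos_sq.
  apply (tends_ell_RInt (fun t => cos t ^ 2) continuous_cos_sq (fun t => pow2_ge_0 (cos t))).
Qed.

Lemma tends_ellD : tends F (fun x => ellD (m x)) (PI / 4).
Proof.
  rewrite <- RInt_sin_sq.
  apply (tends_ell_RInt (fun t => sin t ^ 2) continuous_sin_sq (fun t => pow2_ge_0 (sin t))).
Qed.

Lemma tends_ellK : tends F (fun x => ellK (m x)) (PI / 2).
Proof.
  pose proof tends_ellB; pose proof tends_ellD.
  apply (tends_ext (fun x => ellB (m x) + ellD (m x))).
  - revert m_bounds; apply filter_imp; intros x Hm; symmetry; now apply ellK_eq.
  - tends_rational; field.
Qed.

Lemma tends_ellE : tends F (fun x => ellE (m x)) (PI / 2).
Proof.
  pose proof tends_ellB; pose proof tends_ellD.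
  apply (tends_ext (fun x => ellB (m x) + (1 - m x) * ellD (m x))).
  - revert m_bounds; apply filter_imp; intros x Hm; symmetry; now apply ellE_eq.
  - tends_rational; field.
Qed.

Lemma tends_ellPi : tends F n 0 -> tends F (fun x => ellPi (n x) (m x)) (PI / 2).
Proof.
  intros Hn; pose proof tends_ellK.
  apply (tends_squeeze (fun x => ellK (m x)) _ (fun x => / (1 - n x) * ellK (m x))).
  - generalize (filter_and _ _ n_bounds m_bounds); apply filter_imp; intros x [Hnx Hmx].
    split; [apply ellK_le_ellPi|apply ellPi_le]; lra.
  - assumption.
  - tends_rational; [lra|field].
Qed.

End ParameterTo0.

Section ParameterTo1.

Hypothesis m_to_1 : tends F m 1.

Lemma tends_sqrt_compl : tends F (fun x => sqrt (1 - m x)) 0.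
Proof. tends_rational; rewrite Rminus_diag; exact sqrt_0. Qed.

Lemma ellD_diverges : filterlim (fun x => ellD (m x)) F (Rbar_locally p_infty).
Proof.
  intros P [M HM].
  assert (Hsmall : F (fun x => sqrt (1 - m x) < exp (- (M + 1))))
    by exact (tends_sqrt_compl _ (open_lt _ _ (exp_pos (- (M + 1))))).
  change (F (fun x => P (ellD (m x)))).
  generalize (filter_and _ _ m_bounds Hsmall); apply filter_imp; intros x [Hm Hx].
  apply HM.
  pose proof (ln_increasing _ _ (sqrt_lt_R0 (1 - m x) ltac:(lra)) Hx) as Hln.
  rewrite ln_exp in Hln.
  pose proof (ellK_ge_ln (m x) ltac:(lra)) as HK; rewrite ellK_eq in HK by lra.
  pose proof (ellB_le_1 (m x) ltac:(lra)); lra.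
Qed.

Lemma tends_ellB_div_ellD : tends F (fun x => ellB (m x) / ellD (m x)) 0.
Proof.
  apply (tends_squeeze (fun _ => 0) _ (fun x => / ellD (m x))).
  - revert m_bounds; apply filter_imp; intros x Hm.
    pose proof (ellB_pos _ Hm); pose proof (ellD_pos _ Hm); split.
    + apply Rdiv_le_0_compat; lra.
    + rewrite <- (Rmult_1_l (/ _)); apply Rmult_le_compat_r; [|apply ellB_le_1; lra].
      now apply Rlt_le, Rinv_0_lt_compat.
  - apply tends_const.
  - apply (filterlim_comp _ _ _ _ Rinv _ _ _ ellD_diverges).
    now apply (filterlim_Rbar_inv p_infty).
Qed.

Lemma tends_ellPi_div_ellD (n0 : R) : n0 < 1 -> tends F n n0 ->
  tends F (fun x => ellPi (n x) (m x) / ellD (m x)) (/ (1 - n0)).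
Proof.
  intros Hn0 Hn; pose proof tends_ellB_div_ellD.
  apply (tends_squeeze
    (fun x => / (1 - n x)
              + (1 - 2 * n x) * (/ (1 - n x) * / (1 - n x)) * (ellB (m x) / ellD (m x))) _
    (fun x => / (1 - n x) * (ellB (m x) / ellD (m x) + 1))).
  - generalize (filter_and _ _ n_bounds m_bounds); apply filter_imp; intros x [Hnx Hmx].
    pose proof (ellD_pos _ Hmx) as HD.
    pose proof (ellPi_ge (n x) (m x) ltac:(lra) ltac:(lra)) as Hlower.
    pose proof (ellPi_le (n x) (m x) Hnx ltac:(lra)) as Hupper; rewrite ellK_eq in Hupper by lra.
    split; [apply Rle_div_r|apply Rle_div_l]; trivial.
    + eapply Rle_trans; [|exact Hlower]; right; field; lra.
    + apply (Rle_trans _ _ _ Hupper); right; field; lra.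
  - tends_rational; try lra; field; lra.
  - tends_rational; try lra; field; lra.
Qed.

Lemma tends_compl_mul_ellPi (n0 : R) : n0 < 1 -> tends F n n0 ->
  tends F (fun x => (1 - m x) * ellPi (n x) (m x)) 0.
Proof.
  intros Hn0 Hn; pose proof tends_sqrt_compl.
  apply (tends_squeeze (fun _ => 0) _ (fun x => PI / 2 * / (1 - n x) * sqrt (1 - m x))).
  - generalize (filter_and _ _ n_bounds m_bounds); apply filter_imp; intros x [Hnx Hmx].
    pose proof (ellPi_pos _ _ Hnx Hmx); split; [apply Rmult_le_pos; lra|].
    pose proof (ellPi_le (n x) (m x) Hnx ltac:(lra)) as Hupper.
    pose proof (ellK_le (m x) Hmx) as HK.
    assert (Hroot : 0 < sqrt (1 - m x)) by (apply sqrt_lt_R0; lra).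
    assert (0 < / (1 - n x)) by (apply Rinv_0_lt_compat; lra).
    apply Rle_trans with ((1 - m x) * (/ (1 - n x) * (PI / 2 * / sqrt (1 - m x)))).
    + apply Rmult_le_compat_l; [lra|].
      apply (Rle_trans _ _ _ Hupper), Rmult_le_compat_l; lra.
    + rewrite <- (sqrt_sqrt (1 - m x)) at 1 by lra; right; field; lra.
  - apply tends_const.
  - tends_rational; [lra|ring].
Qed.

End ParameterTo1.

End EllipticLimits.

(** * Coalescing Riemann invariants *)

Section CorrectionLimits.

Context {T : Type} {F : (T -> Prop) -> Prop} {FF : Filter F}.
Variables a b c : T -> R.
Hypothesis ordered : F (fun x => 0 < a x /\ a x < b x /\ b x < c x).

Let m (x : T) : R := ell_param (a x) (b x) (c x).
Let n (x : T) : R := ell_char (a x) (b x).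

Lemma family_param_bounds : F (fun x => 0 <= m x < 1).
Proof.
  revert ordered; apply filter_imp; intros x (Ha & Hb & Hc); now apply ell_param_bounds.
Qed.

Lemma family_char_bounds : F (fun x => 0 <= n x < 1).
Proof.
  revert ordered; apply filter_imp; intros x (Ha & Hb & _); now apply ell_char_bounds.
Qed.

Section Harmonic.

Variables w v : R.
Hypotheses (w_pos : 0 < w) (w_lt_v : w < v).
Hypotheses (a_to_w : tends F a w) (b_to_w : tends F b w) (c_to_v : tends F c v).

Lemma harmonic_param : tends F m 0.
Proof. unfold m, ell_param; tends_rational; [nra|field; lra]. Qed.

Lemma harmonic_char : tends F n 0.
Proof. unfold n, ell_char; tends_rational; [lra|field; lra]. Qed.

Lemma tends_correction_size_harmonic (gap scale ell : T -> R) (gap0 scale0 ell0 : R) :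
  0 < scale0 -> 0 < ell0 -> tends F gap gap0 -> tends F scale scale0 -> tends F ell ell0 ->
  tends F (fun x => correction_size (a x) (b x) (c x) (gap x) (scale x) (ell x))
    (w * gap0 * PI / (scale0 * ell0)).
Proof.
  intros Hscale0 Hell0 Hgap Hscale Hell.
  pose proof (tends_ellPi n m family_char_bounds family_param_bounds harmonic_param harmonic_char).
  unfold correction_size; tends_rational; [nra|field; lra].
Qed.

Lemma tends_speed_correction1_harmonic :
  tends F (fun x => speed_correction1 (a x) (b x) (c x)) (- (4 * w * (v - w) / v)).
Proof.
  pose proof PI_RGT_0; eapply tends_eq.
  - apply tends_opp, (tends_correction_size_harmonic _ _ _ (v - w) v (PI / 4)); try lra.
    + now apply tends_minus.
    + exact c_to_v.
    + exact (tends_ellD m family_param_bounds harmonic_param).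
  - field; lra.
Qed.

Lemma tends_speed_correction2_harmonic :
  tends F (fun x => speed_correction2 (a x) (b x) (c x)) (- (4 * w * (v - w) / v)).
Proof.
  pose proof PI_RGT_0; eapply tends_eq.
  - apply tends_opp, (tends_correction_size_harmonic _ _ _ (v - w) v (PI / 4)); try lra.
    + now apply tends_minus.
    + exact c_to_v.
    + exact (tends_ellB m family_param_bounds harmonic_param).
  - field; lra.
Qed.

Lemma tends_speed_correction3_harmonic :
  tends F (fun x => speed_correction3 (a x) (b x) (c x)) (2 * (v - w)).
Proof.
  pose proof PI_RGT_0; eapply tends_eq.
  - apply (tends_correction_size_harmonic _ _ _ (v - w) w (PI / 2)); try lra.
    + now apply tends_minus.
    + exact b_to_w.
    + exact (tends_ellE m family_param_bounds harmonic_param).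
  - field; lra.
Qed.

End Harmonic.

Section Soliton.

Variables u v : R.
Hypotheses (u_pos : 0 < u) (u_lt_v : u < v).
Hypotheses (a_to_u : tends F a u) (b_to_v : tends F b v) (c_to_v : tends F c v).

Lemma soliton_param : tends F m 1.
Proof. unfold m, ell_param; tends_rational; [nra|field; lra]. Qed.

Lemma soliton_char : tends F n (1 - u / v).
Proof. unfold n, ell_char; tends_rational; [lra|field; lra]. Qed.

Lemma soliton_char_lt_1 : 1 - u / v < 1.
Proof. assert (0 < u / v) by (apply Rdiv_lt_0_compat; lra); lra. Qed.

Lemma tends_speed_correction1_soliton :
  tends F (fun x => speed_correction1 (a x) (b x) (c x)) (- (2 * (v - u))).
Proof.
  pose proof (tends_ellPi_div_ellD n m family_char_bounds family_param_bounds soliton_param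
    _ soliton_char_lt_1 soliton_char).
  apply (tends_ext (fun x => - (2 * a x * (c x - a x) / c x * (ellPi (n x) (m x) / ellD (m x))))).
  - generalize (filter_and _ _ family_param_bounds ordered); apply filter_imp.
    intros x [Hm (Ha & Hb & Hc)]; pose proof (ellD_pos _ Hm).
    unfold speed_correction1, correction_size; fold (m x) (n x); field; lra.
  - eapply tends_eq; [apply tends_opp; tends_rational; [lra|reflexivity]|field; lra].
Qed.

(* [c - b = (1 - m) * b * (c - a) / a], and [(1 - m) * ellPi n m] tends to [0]. *)
Lemma tends_correction_size_soliton (scale ell : T -> R) (scale0 : R) :
  0 < scale0 -> tends F scale scale0 -> F (fun x => 0 < scale x) ->
  F (fun x => PI / 4 <= ell x) ->
  tends F (fun x => correction_size (a x) (b x) (c x) (c x - b x) (scale x) (ell x)) 0.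
Proof.
  intros Hscale0 Hscale Hscale_pos Hell.
  pose proof (tends_compl_mul_ellPi n m family_char_bounds family_param_bounds soliton_param
    _ soliton_char_lt_1 soliton_char).
  pose proof PI_RGT_0.
  apply (tends_ext (fun x =>
    2 * b x * (c x - a x) / scale x * ((1 - m x) * ellPi (n x) (m x)) / ell x)).
  - generalize (filter_and _ _ (filter_and _ _ Hscale_pos Hell) ordered); apply filter_imp.
    intros x [[Hscale_x Hell_x] (Ha & Hb & Hc)]; unfold correction_size; fold (n x) (m x).
    unfold m at 1; rewrite ell_param_compl by assumption; fold (m x); field; lra.
  - apply (tends_0_div _ _ (PI / 4)).
    + lra.
    + generalize (filter_and _ _ (filter_and _ _ family_char_bounds family_param_bounds)
        (filter_and _ _ (filter_and _ _ Hscale_pos Hell) ordered)); apply filter_imp.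
      intros x [[Hn Hm] [[Hscale_x Hell_x] (Ha & Hb & Hc)]].
      pose proof (ellPi_pos _ _ Hn Hm); split; [|exact Hell_x].
      repeat apply Rmult_le_pos; try lra; apply Rlt_le, Rinv_0_lt_compat, Hscale_x.
    + tends_rational; [lra|ring].
Qed.

Lemma tends_speed_correction2_soliton : tends F (fun x => speed_correction2 (a x) (b x) (c x)) 0.
Proof.
  eapply tends_eq; [apply tends_opp, (tends_correction_size_soliton _ _ v)|ring].
  - lra.
  - exact c_to_v.
  - revert ordered; apply filter_imp; intros x; lra.
  - generalize family_param_bounds; apply filter_imp; intros x; apply ellB_ge.
Qed.

Lemma tends_speed_correction3_soliton : tends F (fun x => speed_correction3 (a x) (b x) (c x)) 0.
Proof.
  apply (tends_correction_size_soliton _ _ v).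
  - lra.
  - exact b_to_v.
  - revert ordered; apply filter_imp; intros x; lra.
  - generalize family_param_bounds; apply filter_imp; intros x; apply ellE_ge.
Qed.

End Soliton.

End CorrectionLimits.

Section SpeedLimits.

Context {T : Type} {F : (T -> Prop) -> Prop} {FF : Filter F}.
Variables (nu : R) (U1 U2 U3 : T -> R).
Hypothesis ordered : F (fun x => - nu < U1 x /\ U1 x < U2 x /\ U2 x < U3 x).

Let a (x : T) : R := U1 x + nu.
Let b (x : T) : R := U2 x + nu.
Let c (x : T) : R := U3 x + nu.

Lemma family_ordered : F (fun x => 0 < a x /\ a x < b x /\ b x < c x).
Proof. revert ordered; apply filter_imp; unfold a, b, c; intros x Hx; lra. Qed.

Lemma tends_speed (C correction : T -> R) (l1 l2 l3 d l : R) :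
  F (fun x => C x = U1 x + U2 x + U3 x + 2 * nu + correction x) ->
  tends F U1 l1 -> tends F U2 l2 -> tends F U3 l3 -> tends F correction d ->
  l1 + l2 + l3 + 2 * nu + d = l -> tends F C l.
Proof.
  intros HC HU1 HU2 HU3 Hcorrection <-.
  apply (tends_ext (fun x => U1 x + U2 x + U3 x + 2 * nu + correction x)).
  - revert HC; apply filter_imp; now symmetry.
  - tends_rational; reflexivity.
Qed.

Lemma eventually_Cspeed1_eq : F (fun x =>
  Cspeed1 nu (U1 x) (U2 x) (U3 x)
  = U1 x + U2 x + U3 x + 2 * nu + speed_correction1 (a x) (b x) (c x)).
Proof. revert ordered; apply filter_imp; intros x Hx; now apply Cspeed1_eq. Qed.

Lemma eventually_Cspeed2_eq : F (fun x =>
  Cspeed2 nu (U1 x) (U2 x) (U3 x)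
  = U1 x + U2 x + U3 x + 2 * nu + speed_correction2 (a x) (b x) (c x)).
Proof. revert ordered; apply filter_imp; intros x Hx; now apply Cspeed2_eq. Qed.

Lemma eventually_Cspeed3_eq : F (fun x =>
  Cspeed3 nu (U1 x) (U2 x) (U3 x)
  = U1 x + U2 x + U3 x + 2 * nu + speed_correction3 (a x) (b x) (c x)).
Proof. revert ordered; apply filter_imp; intros x Hx; now apply Cspeed3_eq. Qed.

Lemma soliton_limit (u1 v : R) : - nu < u1 -> u1 < v ->
  tends F U1 u1 -> tends F U2 v -> tends F U3 v ->
  tends F (fun x => Cspeed1 nu (U1 x) (U2 x) (U3 x)) (3 * u1 + 2 * nu) /\
  tends F (fun x => Cspeed2 nu (U1 x) (U2 x) (U3 x)) (u1 + 2 * v + 2 * nu) /\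
  tends F (fun x => Cspeed3 nu (U1 x) (U2 x) (U3 x)) (u1 + 2 * v + 2 * nu).
Proof.
  intros Hu1 Hv HU1 HU2 HU3.
  pose proof (tends_add_const nu _ _ HU1) as Ha; pose proof (tends_add_const nu _ _ HU2) as Hb.
  pose proof (tends_add_const nu _ _ HU3) as Hc.
  assert (Hpos : 0 < u1 + nu) by lra; assert (Hlt : u1 + nu < v + nu) by lra.
  split; [|split].
  - apply (tends_speed _ _ _ _ _ _ _ eventually_Cspeed1_eq HU1 HU2 HU3
      (tends_speed_correction1_soliton a b c family_ordered _ _ Hpos Hlt Ha Hb Hc)); ring.
  - apply (tends_speed _ _ _ _ _ _ _ eventually_Cspeed2_eq HU1 HU2 HU3
      (tends_speed_correction2_soliton a b c family_ordered _ _ Hpos Hlt Ha Hb Hc)); ring.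
  - apply (tends_speed _ _ _ _ _ _ _ eventually_Cspeed3_eq HU1 HU2 HU3
      (tends_speed_correction3_soliton a b c family_ordered _ _ Hpos Hlt Ha Hb Hc)); ring.
Qed.

Lemma harmonic_limit (w u3 : R) : - nu < w -> w < u3 ->
  tends F U1 w -> tends F U2 w -> tends F U3 u3 ->
  let l := 2 * w + u3 + 2 * nu - 4 * (w + nu) * (u3 - w) / (u3 + nu) in
  tends F (fun x => Cspeed3 nu (U1 x) (U2 x) (U3 x)) (3 * u3 + 2 * nu) /\
  tends F (fun x => Cspeed1 nu (U1 x) (U2 x) (U3 x)) l /\
  tends F (fun x => Cspeed2 nu (U1 x) (U2 x) (U3 x)) l.
Proof.
  intros Hw Hu3 HU1 HU2 HU3 l.
  pose proof (tends_add_const nu _ _ HU1) as Ha; pose proof (tends_add_const nu _ _ HU2) as Hb.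
  pose proof (tends_add_const nu _ _ HU3) as Hc.
  assert (Hpos : 0 < w + nu) by lra; assert (Hlt : w + nu < u3 + nu) by lra.
  split; [|split].
  - apply (tends_speed _ _ _ _ _ _ _ eventually_Cspeed3_eq HU1 HU2 HU3
      (tends_speed_correction3_harmonic a b c family_ordered _ _ Hpos Hlt Ha Hb Hc)); ring.
  - apply (tends_speed _ _ _ _ _ _ _ eventually_Cspeed1_eq HU1 HU2 HU3
      (tends_speed_correction1_harmonic a b c family_ordered _ _ Hpos Hlt Ha Hb Hc)).
    unfold l; field; lra.
  - apply (tends_speed _ _ _ _ _ _ _ eventually_Cspeed2_eq HU1 HU2 HU3
      (tends_speed_correction2_harmonic a b c family_ordered _ _ Hpos Hlt Ha Hb Hc)).
    unfold l; field; lra.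
Qed.

End SpeedLimits.

Lemma tends_fst (D : R * R -> Prop) (v w : R) : tends (within D (locally (v, w))) fst v.
Proof.
  apply (filterlim_filter_le_1 (F := locally (v, w)));
    [apply filter_le_within|apply (continuous_fst (U := R_UniformSpace) (V := R_UniformSpace))].
Qed.

Lemma tends_snd (D : R * R -> Prop) (v w : R) : tends (within D (locally (v, w))) snd w.
Proof.
  apply (filterlim_filter_le_1 (F := locally (v, w)));
    [apply filter_le_within|apply (continuous_snd (U := R_UniformSpace) (V := R_UniformSpace))].
Qed.

Lemma within_domain {T : Type} {F : (T -> Prop) -> Prop} {FF : Filter F} (D P : T -> Prop) :
  (forall x, D x -> P x) -> within D F P.
Proof. exact (filter_forall _). Qed.

Theorem theorem2 :
  forall nu : R,
  (* part 1: explicit formulas (with the partial derivatives existing and d k / d u^i <> 0) *)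
  (forall u1 u2 u3 : R, - nu < u1 -> u1 < u2 -> u2 < u3 ->
     let s := smod nu u1 u2 u3 in
     let rho := rhop nu u1 u2 in
     let S := u1 + u2 + u3 + 2 * nu in
     let L := Lam (Kell s) rho s in
     (ex_derive (fun x => kwave nu x u2 u3) u1 /\ ex_derive (fun x => omega nu x u2 u3) u1 /\
      Derive (fun x => kwave nu x u2 u3) u1 <> 0 /\
      ex_derive (fun x => kwave nu u1 x u3) u2 /\ ex_derive (fun x => omega nu u1 x u3) u2 /\
      Derive (fun x => kwave nu u1 x u3) u2 <> 0 /\
      ex_derive (fun x => kwave nu u1 u2 x) u3 /\ ex_derive (fun x => omega nu u1 u2 x) u3 /\
      Derive (fun x => kwave nu u1 u2 x) u3 <> 0) /\
     Cspeed1 nu u1 u2 u3 =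
       S + 2 * (u1 + nu) * (u1 - u2) * L / ((u2 + nu) * (Kell s - Eell s)) /\
     Cspeed2 nu u1 u2 u3 =
       S + 2 * (u2 - u1) * L /
         (Kell s - (u2 + nu) * (u3 - u1) / ((u1 + nu) * (u3 - u2)) * Eell s) /\
     Cspeed3 nu u1 u2 u3 =
       S + 2 * (u1 + nu) * (u3 - u2) * L / ((u2 + nu) * Eell s) /\
     (* part 2: ordering of the characteristic speeds *)
     Cspeed1 nu u1 u2 u3 < Cspeed3 nu u1 u2 u3 /\ Cspeed2 nu u1 u2 u3 < Cspeed3 nu u1 u2 u3) /\
  (* part 3a: u2, u3 -> v *)
  (forall u1 v : R, - nu < u1 -> u1 < v ->
     filterlim (fun p : R * R => Cspeed1 nu u1 (fst p) (snd p))
       (within (fun p : R * R => u1 < fst p /\ fst p < snd p) (locally (v, v)))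
       (locally (3 * u1 + 2 * nu)) /\
     exists l : R,
       filterlim (fun p : R * R => Cspeed2 nu u1 (fst p) (snd p))
         (within (fun p : R * R => u1 < fst p /\ fst p < snd p) (locally (v, v)))
         (locally l) /\
       filterlim (fun p : R * R => Cspeed3 nu u1 (fst p) (snd p))
         (within (fun p : R * R => u1 < fst p /\ fst p < snd p) (locally (v, v)))
         (locally l)) /\
  (* part 3b: u1, u2 -> w *)
  (forall w u3 : R, - nu < w -> w < u3 ->
     filterlim (fun p : R * R => Cspeed3 nu (fst p) (snd p) u3)
       (within (fun p : R * R => - nu < fst p /\ fst p < snd p /\ snd p < u3) (locally (w, w)))
       (locally (3 * u3 + 2 * nu)) /\
     exists l : R,
       filterlim (fun p : R * R => Cspeed1 nu (fst p) (snd p) u3)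
         (within (fun p : R * R => - nu < fst p /\ fst p < snd p /\ snd p < u3) (locally (w, w)))
         (locally l) /\
       filterlim (fun p : R * R => Cspeed2 nu (fst p) (snd p) u3)
         (within (fun p : R * R => - nu < fst p /\ fst p < snd p /\ snd p < u3) (locally (w, w)))
         (locally l)).
Proof.
  intros nu; split; [|split].
  - intros u1 u2 u3 Hu1 Hu2 Hu3 s rho S L.
    destruct (Cspeed1_eq nu u1 u2 u3 Hu1 Hu2 Hu3) as [(dk1 & dom1 & dk1_neq) _].
    destruct (Cspeed2_eq nu u1 u2 u3 Hu1 Hu2 Hu3) as [(dk2 & dom2 & dk2_neq) _].
    destruct (Cspeed3_eq nu u1 u2 u3 Hu1 Hu2 Hu3) as [(dk3 & dom3 & dk3_neq) _].
    split; [now repeat split|].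
    split; [now apply Cspeed1_formula|].
    split; [now apply Cspeed2_formula|].
    split; [now apply Cspeed3_formula|].
    split; [now apply Cspeed1_lt_Cspeed3|now apply Cspeed2_lt_Cspeed3].
  - intros u1 v Hu1 Hv.
    destruct (soliton_limit nu (fun _ : R * R => u1) fst snd
      (within_domain (F := locally (v, v)) _ _ (fun p Hp => conj Hu1 Hp)) u1 v Hu1 Hv
      (tends_const u1) (tends_fst _ v v) (tends_snd _ v v)) as (C1_lim & C2_lim & C3_lim).
    split; [exact C1_lim|]; eexists; split; [exact C2_lim|exact C3_lim].
  - intros w u3 Hw Hu3.
    destruct (harmonic_limit nu fst snd (fun _ : R * R => u3)
      (within_domain (F := locally (w, w)) _ _ (fun p Hp => Hp)) w u3 Hw Hu3
      (tends_fst _ w w) (tends_snd _ w w) (tends_const u3)) as (C3_lim & C1_lim & C2_lim).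
    split; [exact C3_lim|]; eexists; split; [exact C1_lim|exact C2_lim].
Qed.
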